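(* Let $d\ge1$ and $e\ge1$ be integers and let $R$ be the coordinate ring of the weighted rational curve of type $(d,e)$ over a field $k$. The resolution of $k$ as an $R$-module has the following entries as part of its Betti table: $$\beta^R_{i,i}(k)=\begin{cases}1&\text{if } i=0\\ d&\text{if } i=1\\ (d-2)^{i-2}(d-1)^2&\text{if } i\ge2\end{cases}\qquad\text{and}\qquad \beta^R_{i,ei}(k)=\begin{cases}1&\text{if } i=0\\ e(e-1)^{i-1}&\text{if } i\ge1.\end{cases}$$ In particular, the resolution of $k$ over $R$ has both an infinite ''true linear'' strand if $d>2$ and a ''maximally twisted'' strand for all $e>1$, and the Betti numbers in these extremal strands depend only on $d$ and $e$ respectively.
   Context: Let $k$ be a field and $S=k[x_0,\dots,x_{d-1},y_0,\dots,y_{e-1}]$, graded by $\deg x_i=1$, $\deg y_i=e$. Let $\varphi:S\to k[s,t]$ be the $k$-algebra map with $\varphi(x_i)=s^{d-i}t^i$ for $0\le i\le d-1$ and $\varphi(y_i)=s^{e-1-i}t^{ed-(e-1)+i}$ for $0\le i\le e-1$. The weighted rational curve of type $(d,e)$ has defining ideal $I=\ker\varphi$ and coordinate ring $R=S/I$ with the induced grading; $k=R/\mathfrak m$ is the residue field at the homogeneous maximal ideal $\mathfrak m$, and the resolution of $k$ is the minimal graded free resolution over $R$. Graded Betti numbers are $\beta^R_{i,j}(k)=\dim_k\mathrm{Tor}^R_i(k,k)_j$. The ''true linear'' strand is the part of the resolution recorded by the numbers $\beta^R_{i,i}(k)$, and the ''maximally twisted'' strand is the part recorded by the numbers $\beta^R_{i,ei}(k)$.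 In the formulas, $0^0$ is read as $1$.
   Formalization: For e = 1 the displayed formulas are false (R is then the rational normal curve ring and β_{1,1} = d+1), so the formulas for i ≥ 1 and the claim that the strands depend only on d and e respectively are stated for e > 1. *)

(* Defs.v *)
From HB Require Import structures.
From Stdlib Require Import ClassicalEpsilon.
From mathcomp Require Export all_boot all_order all_algebra.
From mathcomp Require Export ring_quotient.
From mathcomp Require Export mpoly.

Set Implicit Arguments.
Unset Strict Implicit.
Unset Printing Implicit Defensive.

Import GRing.Theory.
Local Open Scope ring_scope.
Local Open Scope quotient_scope.

(* R is an N-graded ring, grade n r says that r lies in R_n, and res : R -> k
   is the quotient of R by its homogeneous maximal ideal. *)
Section GradedFreeResolutions.

Variables (k : fieldType) (R : comNzRingType).
Variables (grade : nat -> R -> Prop) (res : R -> k).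

(* The i-th module is F_i = \bigoplus_j R(-j)^(gfc_rank i j), with finitely
   many generators in each degree. The block gfc_diff i j l is the component
   R(-j)^(gfc_rank i.+1 j) -> R(-l)^(gfc_rank i l) of F_{i+1} -> F_i; matrices
   act on row vectors. An augmentation F_0 -> k of degree 0 only sees the
   generators of degree 0. *)
Record gfree_complex := GFreeComplex {
  gfc_rank : nat -> nat -> nat;
  gfc_diff : forall i j l, 'M[R]_(gfc_rank i.+1 j, gfc_rank i l);
  gfc_aug : 'cV[k]_(gfc_rank 0 0)
}.

(* r lies in R(-j)_n. *)
Definition shift_homog (j n : nat) (r : R) : Prop :=
  if (j <= n)%N then grade (n - j) r else r = 0.

Implicit Type F : gfree_complex.

Definition gfc_elt F (i : nat) : Type := forall j, 'rV[R]_(gfc_rank F i j).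

Definition in_degree F (i n : nat) (v : gfc_elt F i) : Prop :=
  forall j a, shift_homog j n (v j 0 a).

(* Only used on elements of degree n, whose coordinates of index j > n vanish. *)
Definition apply_diff F (i n : nat) (v : gfc_elt F i.+1) : gfc_elt F i :=
  fun l => \sum_(j < n.+1) v j *m gfc_diff F i j l.

Definition apply_aug F (v : gfc_elt F 0) : 'M[k]_1 :=
  map_mx res (v 0%N) *m gfc_aug F.

(* Exactness of ... -> F_1 -> F_0 -> k -> 0, checked degree by degree. *)
Definition graded_free_resolution F : Prop :=
  [/\ forall i j l a b, shift_homog l j (gfc_diff F i j l a b),
      gfc_aug F != 0,
      forall n (v : gfc_elt F 0), in_degree n v ->
        (apply_aug v = 0 <->
         exists2 w : gfc_elt F 1, in_degree n w &
           forall l, v l = apply_diff n w l)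
    & forall i n (v : gfc_elt F i.+1), in_degree n v ->
        ((forall l, apply_diff n v l = 0) <->
         exists2 w : gfc_elt F i.+2, in_degree n w &
           forall l, v l = apply_diff n w l)].

Definition minimal_graded_free_resolution F : Prop :=
  graded_free_resolution F /\
  forall i j l a b, res (gfc_diff F i j l a b) = 0.

(* The differential of F (x)_R k in internal degree j: the blocks between
   generators of different degrees have entries of positive degree, and
   vanish in k. *)
Definition res_diff F (i j : nat) : 'M[k]_(gfc_rank F i.+1 j, gfc_rank F i j) :=
  map_mx res (gfc_diff F i j j).

(* dim_k H_i(F (x)_R k)_j *)
Definition homology_dim F (i j : nat) : nat :=
  match i with
  | 0 => gfc_rank F 0 j - \rank (res_diff F 0 j)
  | i'.+1 => \rank (kermx (res_diff F i' j)) - \rank (res_diff F i'.+1 j)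
  end%N.

Definition zero_complex : gfree_complex :=
  @GFreeComplex (fun _ _ => 0%N) (fun _ _ _ => 0) 0.

Definition resolution_of_k : gfree_complex :=
  epsilon (inhabits zero_complex) minimal_graded_free_resolution.

(* dim_k Tor^R_i(k, k)_j *)
Definition graded_betti (i j : nat) : nat :=
  homology_dim resolution_of_k i j.

End GradedFreeResolutions.

Section WeightedRationalCurve.

Variables (k : fieldType) (d e : nat).

(* The first d variables of S are the x_i and the last e are the y_i; in the
   target, 'X_0 is s and 'X_1 is t. *)
Local Notation S := {mpoly k[d + e]}.

Definition st_monomial (a b : nat) : {mpoly k[2]} :=
  'X_ord0 ^+ a * 'X_ord_max ^+ b.

Definition wrc_var (i : 'I_(d + e)) : {mpoly k[2]} :=
  match split i with
  | inl i => st_monomial (d - i) i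
  | inr i => st_monomial (e - 1 - i) (e * d - (e - 1) + i)
  end.

Definition wrc_map (p : S) : {mpoly k[2]} := p \mPo [tuple wrc_var i | i < d + e].

Definition wrc_ideal : {pred S} := fun p => wrc_map p == 0.

Lemma wrc_ideal_closed : idealr_closed wrc_ideal.
Proof.
split=> [||p u v]; rewrite !unfold_in /wrc_map.
- by rewrite comp_mpoly0.
- by rewrite comp_mpoly1 oner_eq0.
by move=> /eqP u0 /eqP v0; rewrite comp_mpolyD rmorphM /= u0 v0 mulr0 addr0.
Qed.

HB.instance Definition _ := isIdealr.Build S wrc_ideal wrc_ideal_closed.

Definition wrc_ring : comNzRingType := {ideal_quot wrc_ideal}.

Definition wrc_pi (p : S) : wrc_ring := \pi_{ideal_quot wrc_ideal} p.

Definition wrc_weight (m : 'X_{1..d + e}) : nat :=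
  \sum_(i < d + e) (if (i < d)%N then 1 else e) * m i.

Lemma wrc_weight0 : wrc_weight 0%MM = 0%N.
Proof. by rewrite /wrc_weight big1 // => i _; rewrite mnm0E muln0. Qed.

Lemma wrc_weightD : {morph wrc_weight : m1 m2 / (m1 + m2)%MM >-> (m1 + m2)%N}.
Proof.
move=> m1 m2; rewrite /wrc_weight -big_split /=.
by apply: eq_bigr => i _; rewrite mnmDE mulnDr.
Qed.

HB.instance Definition _ :=
  isMeasure.Build (d + e)%N wrc_weight wrc_weight0 wrc_weightD.

Definition wrc_homog (n : nat) (r : wrc_ring) : Prop :=
  exists2 p : S, p \is n.-homog for wrc_weight & r = wrc_pi p.

(* R -> R/m = k; independent of the representative by wrc_resE. *)
Definition wrc_res (r : wrc_ring) : k :=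
  (repr (r : {ideal_quot wrc_ideal}) : S)@_0%MM.

Lemma wrc_resE (p : S) : (0 < d)%N -> wrc_res (wrc_pi p) = p@_0%MM.
Proof.
move=> d_gt0.
have meval0E n (q : {mpoly k[n]}) : q.@[fun=> 0] = q@_0%MM.
  rewrite {1}[q]mpolyE raddf_sum /=.
  transitivity (\sum_(m <- msupp q) q@_m * (m == 0%MM)%:R).
    apply: eq_bigr => m _; rewrite mevalZ mevalX; congr (_ * _).
    have [->|m_neq0] := eqVneq m 0%MM.
      by rewrite big1 // => i _; rewrite mnm0E expr0.
    have [i mi] : exists i, m i != 0%N.
      apply/existsP; apply: contraR m_neq0 => /existsPn m0.
      by apply/eqP/mnmP => i; rewrite mnm0E; apply/eqP; rewrite -[_ == _]negbK m0.
    by rewrite (bigD1 i) //= expr0n (negPf mi) mul0r.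
  rewrite [in RHS](mpolyE q) raddf_sum /=.
  by apply: eq_bigr => m _; rewrite mcoeffZ mcoeffX.
have map0 (q : S) : (wrc_map q)@_0%MM = q@_0%MM.
  rewrite -!meval0E comp_mpoly_meval; apply: meval_eq => i.
  rewrite tnth_mktuple /wrc_var /st_monomial.
  case: split => j; rewrite mevalM !rmorphXn /= !mevalXU !expr0n.
    have: ((d - j)%N == 0%N) = false by rewrite subn_eq0 leqNgt ltn_ord.
    by move=> ->; rewrite mul0r.
  suff -> : (e * d - (e - 1) + j)%N == 0%N = false by rewrite mulr0.
  have e_gt0 : (0 < e)%N by case: (e) j => [[]|].
  apply/negbTE; rewrite addn_eq0 negb_and subn_eq0 -ltnNge.
  by rewrite (@leq_trans e) ?leq_pmulr // ltn_subrL e_gt0.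
apply/eqP; rewrite /wrc_res -subr_eq0 -mcoeffB -map0.
suff /eqP -> : wrc_map (repr (\pi_{ideal_quot wrc_ideal} p) - p) == 0.
  by rewrite mcoeff0.
have : (repr (\pi_{ideal_quot wrc_ideal} p) - p) \in wrc_ideal.
  by rewrite Quotient.idealrBE reprK.
by [].
Qed.

Definition wrc_betti (i j : nat) : nat := graded_betti wrc_homog wrc_res i j.

End WeightedRationalCurve.

Definition infinite_strand (b : nat -> nat) : Prop :=
  forall n, exists2 i, (n <= i)%N & b i != 0%N.

(* Main.v *)
Require Import Defs.
From HB Require Import structures.
From Stdlib Require Import ClassicalEpsilon FunctionalExtensionality.
From mathcomp Require Import all_boot all_order all_algebra.
From mathcomp Require Import zify.

(* Setting s = 1 identifies R_n with the span of the t^b with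
   0 <= b <= nd - (n mod e). Index the variables by letters 0, ..., D + e with
   D = d - 1. Every monomial of R has a unique normal word: a power of the
   letter D, then at most one letter l, then a power of the extreme letter on
   the side of l (0 if l < D, and D + e if l > D). Normality only involves
   adjacent letters, so an Anick-type construction resolves k: a basis of the
   i-th module is given by the words of length i all of whose adjacent pairs are
   forbidden in normal words. The first letters of normal words define an
   associative product of letters with absorbing element D, and the differential
   is the alternating sum of the faces which merge two neighbours or drop the
   last letter, so that it squares to 0. Exactness is a leading term argument.
   The differential strictly lowers the weight of words, so the resolution is
   minimal, and the Betti numbers of both strands count words whose letters are
   all <= D or all > D. *)

Set Implicit Arguments.
Unset Strict Implicit.
Unset Printing Implicit Defensive.

Import GRing.Theory.

Local Open Scope ring_scope.

(** * Betti numbers and minimal resolutions *)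

Section Comparison.

Variables (k : fieldType) (R : comNzRingType) (grade : nat -> R -> Prop).
Variable res : {rmorphism R -> k}.

Hypothesis grade0 : forall n, grade n 0.
Hypothesis gradeB : forall n r s, grade n r -> grade n s -> grade n (r - s).
Hypothesis gradeM :
  forall m n r s, grade m r -> grade n s -> grade (m + n) (r * s).
Hypothesis grade1 : grade 0 1.
Hypothesis grade_lift : forall c, exists2 r, grade 0 r & res r = c.

Lemma shift_homog0 j n : shift_homog grade j n 0.
Proof. by rewrite /shift_homog; case: ifP. Qed.

Lemma shift_homogB j n r s : shift_homog grade j n r ->
  shift_homog grade j n s -> shift_homog grade j n (r - s).
Proof.
rewrite /shift_homog; case: ifP => _; first exact: gradeB.
by move=> -> ->; rewrite subrr.
Qed.

Lemma shift_homogD j n r s : shift_homog grade j n r ->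
  shift_homog grade j n s -> shift_homog grade j n (r + s).
Proof.
move=> hr hs; rewrite -[s]opprK -[- s]add0r.
by apply: shift_homogB => //; apply: shift_homogB => //; apply: shift_homog0.
Qed.

Lemma shift_homog_sum j n I (s : seq I) (P : pred I) (F : I -> R) :
  (forall i, P i -> shift_homog grade j n (F i)) ->
  shift_homog grade j n (\sum_(i <- s | P i) F i).
Proof.
move=> hF; elim/big_ind: _ => //; first exact: shift_homog0.
exact: shift_homogD.
Qed.

Lemma shift_homogM m l j r s : shift_homog grade l j r ->
  shift_homog grade m l s -> shift_homog grade m j (r * s).
Proof.
rewrite /shift_homog; case: (leqP l j) => [lj hr|_ ->]; last first.
  by move=> _; rewrite mul0r; case: ifP.
case: (leqP m l) => [ml hs|_ ->]; last by rewrite mulr0; case: ifP.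
rewrite (leq_trans ml lj); have -> : (j - m = (j - l) + (l - m))%N by rewrite addnBA // subnK.
exact: gradeM.
Qed.

Implicit Types p q : nat -> nat.

(** * Block matrices between graded free modules *)

Definition blk p q := forall j l, 'M[R]_(p j, q l).

Lemma blkP p q (A B : blk p q) : (forall j l, A j l = B j l) -> A = B.
Proof.
by move=> eqAB; do 2![apply: functional_extensionality_dep => ?].
Qed.

(** For a homogeneous [A] the blocks [A j m] with [m > j] vanish, so the truncated sum is the full
    composite: [A] first, then [B]. *)
Definition bmul p q r (A : blk p q) (B : blk q r) : blk p r :=
  fun j l => \sum_(m < j.+1) A j m *m B m l.

Definition bsub p q (A B : blk p q) : blk p q := fun j l => A j l - B j l.

(** Indices are compared in [nat], since the blocks [j] and [l] have sizes that agree only when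
    [j = l]. *)
Definition bid p : blk p p :=
  fun j l => \matrix_(a, b) ((j == l) && (a == b :> nat))%:R.

Definition bhom p q (A : blk p q) :=
  forall j l a b, shift_homog grade l j (A j l a b).

Lemma bhom_gt p q (A : blk p q) j l : bhom A -> (j < l)%N -> A j l = 0.
Proof.
move=> hA jl; apply/matrixP => a b; have := hA j l a b.
by rewrite /shift_homog leqNgt jl mxE.
Qed.

Lemma bhom_id p : bhom (@bid p).
Proof.
move=> j l a b; rewrite mxE; case: andP => [[/eqP jl _]|_] /=.
  by rewrite jl /shift_homog leqnn subnn.
exact: shift_homog0.
Qed.

Lemma bhom_mul p q r (A : blk p q) (B : blk q r) :
  bhom A -> bhom B -> bhom (bmul A B).
Proof.
move=> hA hB j l a b; rewrite summxE; apply: shift_homog_sum => m _.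
by rewrite mxE; apply: shift_homog_sum => c _; apply: shift_homogM.
Qed.

Lemma bhom_sub p q (A B : blk p q) : bhom A -> bhom B -> bhom (bsub A B).
Proof. by move=> hA hB j l a b; rewrite !mxE; apply: shift_homogB. Qed.

(** The two double sums differ only by terms containing [B m x] with [m < x], which vanish by
    homogeneity of [B]. *)
Lemma bmulA p q r t (A : blk p q) (B : blk q r) (C : blk r t) : bhom B ->
  bmul A (bmul B C) = bmul (bmul A B) C.
Proof.
move=> hB; apply: blkP => j l; rewrite /bmul.
under eq_bigr => m _ do rewrite mulmx_sumr.
under [RHS]eq_bigr => m _ do rewrite mulmx_suml.
rewrite [RHS]exchange_big /=; apply: eq_bigr => m _.
rewrite -(big_mkord xpredT (fun x => A j m *m (B m x *m C x l))).
rewrite -(big_mkord xpredT (fun x => A j m *m B m x *m C x l)).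
rewrite [RHS](big_cat_nat (n := m.+1)) //=.
rewrite [X in _ + X]big_nat_cond [X in _ + X]big1 ?addr0; last first.
  move=> x; rewrite andbT => /andP[mx _].
  by rewrite (bhom_gt hB) // mulmx0 mul0mx.
by apply: eq_bigr => x _; rewrite mulmxA.
Qed.

Lemma bid_eq p j : bid p j j = 1%:M.
Proof. by apply/matrixP => a b; rewrite !mxE eqxx. Qed.

Lemma bid_neq p j l : j != l -> bid p j l = 0.
Proof. by move=> /negPf jl; apply/matrixP => a b; rewrite !mxE jl. Qed.

Lemma bmul1l p q (A : blk p q) : bmul (@bid p) A = A.
Proof.
apply: blkP => j l; rewrite /bmul (bigD1 ord_max) //= bid_eq mul1mx big1 ?addr0//.
move=> m; rewrite -(inj_eq val_inj) /= eq_sym => jm.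
by rewrite bid_neq // mul0mx.
Qed.

Lemma bmul1r p q (A : blk p q) : bhom A -> bmul A (@bid q) = A.
Proof.
move=> hA; apply: blkP => j l; rewrite /bmul.
have [lj|jl] := leqP l j; last first.
  rewrite (bhom_gt hA) // big1 // => m _; rewrite bid_neq ?mulmx0 //.
  by rewrite neq_ltn (leq_trans (ltn_ord m)).
rewrite (bigD1 (Ordinal (lj : (l < j.+1)%N))) //= bid_eq mulmx1 big1 ?addr0//.
by move=> m; rewrite -(inj_eq val_inj) /= => ml; rewrite bid_neq // mulmx0.
Qed.

Lemma bmulBl p q r (A B : blk p q) (C : blk q r) :
  bmul (bsub A B) C = bsub (bmul A C) (bmul B C).
Proof.
apply: blkP => j l; rewrite /bmul /bsub -sumrB.
by apply: eq_bigr => m _; rewrite mulmxBl.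
Qed.

Lemma bmulBr p q r (A : blk p q) (B C : blk q r) :
  bmul A (bsub B C) = bsub (bmul A B) (bmul A C).
Proof.
apply: blkP => j l; rewrite /bmul /bsub -sumrB.
by apply: eq_bigr => m _; rewrite mulmxBr.
Qed.

Lemma bmul0l p q r (A : blk p q) (B : blk q r) j l :
  (forall j l, A j l = 0) -> bmul A B j l = 0.
Proof. by move=> A0; rewrite /bmul big1 // => m _; rewrite A0 mul0mx. Qed.

Lemma map_bmul p q r (A : blk p q) (B : blk q r) j l :
  map_mx res (bmul A B j l) =
  \sum_(m < j.+1) map_mx res (A j m) *m map_mx res (B m l).
Proof. by rewrite map_mx_sum; apply: eq_bigr => m _; rewrite map_mxM. Qed.

(** * Comparison maps between resolutions *)

Local Notation complex := (gfree_complex k R).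
Local Notation diff := (@gfc_diff k R).
Local Notation rk := (@gfc_rank k R).

(** The map out of [G_i] is the augmentation for [i = 0], which only sees the generators of degree
    0. *)
Definition bcycle (G : complex) i p : blk p (rk G i) -> Prop :=
  match i with
  | 0 => fun A => forall j, map_mx res (A j 0) *m gfc_aug G = 0
  | i'.+1 => fun A => forall j l, bmul A (diff G i') j l = 0
  end.

Definition brow p q (A : blk p q) j (a : 'I_(p j)) : forall l, 'rV[R]_(q l) :=
  fun l => row a (A j l).

(** Row [a] of the blocks [A j l] is an element of degree [j] of [G_i], so exactness of [G] applies
    to each row separately. *)
Lemma bcycle_row (G : complex) i p (A : blk p (rk G i)) :
    graded_free_resolution grade res G -> bhom A ->
  bcycle A <-> forall j (a : 'I_(p j)),
    exists2 w : gfc_elt G i.+1, in_degree grade j w &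
      forall l, brow A a l = apply_diff j w l.
Proof.
case=> _ _ exact0 exactS hA.
have hrow j (a : 'I_(p j)) : in_degree grade j (brow A a : gfc_elt G i).
  by move=> l b; rewrite mxE.
case: i A hA hrow => [|i] A hA hrow; split=> /= cA j.
- by move=> a; apply/exact0 => //; rewrite /apply_aug map_row -row_mul cA row0.
- apply/row_matrixP => a; rewrite row_mul row0 -map_row.
  by have /exact0 := cA j a; apply.
- move=> a; apply/exactS => // l.
  transitivity (row a (bmul A (diff G i) j l)); last by rewrite cA row0.
  rewrite [RHS]linear_sum; apply: eq_bigr => m _ /=.
  by rewrite (row_mul a (A j m)).
- move=> l; apply/row_matrixP => a; rewrite linear_sum row0.
  under eq_bigr => m _ do rewrite /= (row_mul a (A j m)).
  by have /exactS := cA j a; apply.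
Qed.

(** Projectivity of free modules: a preimage is chosen for each row, and the chosen rows are
    assembled into a matrix. *)
Lemma bcycle_lift (G : complex) i p (A : blk p (rk G i)) :
    graded_free_resolution grade res G -> bhom A -> bcycle A ->
  exists2 B : blk p (rk G i.+1), bhom B & bmul B (diff G i) = A.
Proof.
move=> rG hA /(bcycle_row rG hA) rows.
have inh : inhabited (gfc_elt G i.+1) by exists => j; exact: 0.
pose P j (a : 'I_(p j)) (w : gfc_elt G i.+1) :=
  in_degree grade j w /\ forall l, brow A a l = apply_diff j w l.
pose w j (a : 'I_(p j)) := epsilon inh (P j a).
have wP j (a : 'I_(p j)) : P j a (w j a).
  by apply: (epsilon_spec inh (P j a)); case: (rows j a) => v; exists v.
exists (fun j l => \matrix_a w j a l).
  by move=> j l a b; rewrite mxE; case: (wP j a) => + _; apply.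
apply: blkP => j l; apply/row_matrixP => a; rewrite linear_sum.
have [_ /(_ l)] := wP j a; rewrite /brow => ->; apply: eq_bigr => m _ /=.
by rewrite (row_mul a (\matrix_b w j b m)) rowK.
Qed.

Lemma bcycle_diff (G : complex) i p (B : blk p (rk G i.+1)) :
    graded_free_resolution grade res G -> bhom B ->
  bcycle (bmul B (diff G i)).
Proof.
move=> rG hB; have hd : bhom (diff G i) by case: rG => h _ _ _; apply: h.
apply/(bcycle_row rG); first exact: bhom_mul.
move=> j a; exists (brow B a); first by move=> l b; rewrite mxE.
by move=> l; rewrite /brow linear_sum; apply: eq_bigr => m _ /=; rewrite (row_mul a (B j m)).
Qed.

(** The identity of k lifts to [F_0 -> G_0]: fix a generator [b] of [G_0] with nonzero augmentation
    and send each generator of degree 0 to the multiple of [b] with the right augmentation. *)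
Lemma bcycle_aug_lift (F G : complex) :
    graded_free_resolution grade res G ->
  exists2 A : blk (rk F 0) (rk G 0), bhom A &
    forall j, map_mx res (A j 0) *m gfc_aug G =
              map_mx res (@bid (rk F 0) j 0) *m gfc_aug F.
Proof.
case=> _ /eqP aug_neq0 _ _.
have [b augb] : exists b, gfc_aug G b 0 != 0.
  apply/existsP; apply: contraPT isT => /existsPn aug0; case: aug_neq0.
  by apply/matrixP => b c; rewrite (ord1 c) mxE; apply/eqP/negPn/aug0.
have inh : inhabited R by exists; exact: 0.
pose P c r := grade 0 r /\ res r = c.
pose h c := epsilon inh (P c).
have hP c : P c (h c).
  by apply: (epsilon_spec inh (P c)); case: (grade_lift c) => r; exists r.
pose M : 'M[R]_(rk F 0 0, rk G 0 0) :=
  \matrix_(a, b') if b' == b then h (gfc_aug F a 0 / gfc_aug G b 0) else 0.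
exists (fun j l => match j, l return 'M[R]_(rk F 0 j, rk G 0 l) with
                   | 0, 0 => M | _, _ => 0 end).
  move=> [|j] [|l] a c; try by rewrite mxE; apply: shift_homog0.
  rewrite mxE; case: eqP => _; last exact: shift_homog0.
  by case: (hP (gfc_aug F a 0 / gfc_aug G b 0)).
case=> [|j].
  rewrite bid_eq map_mx1 mul1mx; apply/matrixP => a c; rewrite (ord1 c) !mxE.
  rewrite (bigD1 b) //= big1 ?addr0 => [|i ib].
    by rewrite !mxE eqxx; have [_ ->] := hP (gfc_aug F a 0 / gfc_aug G b 0); rewrite divfK.
  by rewrite !mxE (negPf ib) rmorph0 mul0r.
by rewrite bid_neq // !map_mx0 !mul0mx.
Qed.

Section Rank.

Variables F G : complex.
Hypothesis rF : minimal_graded_free_resolution grade res F.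
Hypothesis rG : graded_free_resolution grade res G.

Let hdF i : bhom (diff F i). Proof. by case: rF => [[h _ _ _] _]; apply: h. Qed.
Let hdG i : bhom (diff G i). Proof. by case: rG => h _ _ _; apply: h. Qed.

Let bcycle_diff1 (H : complex) i : graded_free_resolution grade res H ->
  bcycle (diff H i).
Proof.
by move=> rH; rewrite -[diff H i]bmul1l; apply: bcycle_diff => //; apply: bhom_id.
Qed.

Let map_diffF i j l : map_mx res (diff F i j l) = 0.
Proof. by apply/matrixP => a b; rewrite !mxE; case: rF. Qed.

(* The comparison maps [Phi : F_i -> G_i], [Psi : G_i -> F_i] and the homotopy
   [s] from [Psi o Phi] to the identity are extended one step at a time; the
   third condition is what the next step needs to know about [s]. *)
Lemma comparison_step i :
  exists (Phi : blk (rk F i) (rk G i)) (Psi : blk (rk G i) (rk F i))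
         (s : blk (rk F i) (rk F i.+1)),
  [/\ [/\ bhom Phi, bhom Psi & bhom s],
      bcycle (bmul (diff F i) Phi) /\ bcycle (bmul (diff G i) Psi),
      bmul (diff F i) (bsub (bmul Phi Psi) (@bid _)) =
        bmul (diff F i) (bmul s (diff F i))
    & forall j, map_mx res (bmul Phi Psi j j) = 1%:M].
Proof.
have rF' := rF.1.
have augP (F' G' : complex) (Phi : blk (rk F' 0) (rk G' 0)) p (A : blk p (rk F' 0)) :
    (forall j, map_mx res (Phi j 0) *m gfc_aug G' =
              map_mx res (@bid (rk F' 0) j 0) *m gfc_aug F') ->
    forall j, map_mx res (bmul A Phi j 0) *m gfc_aug G' =
       map_mx res (A j 0) *m gfc_aug F'.
  move=> hPhi j; rewrite map_bmul mulmx_suml big_ord_recl /= -mulmxA hPhi.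
  rewrite bid_eq map_mx1 mul1mx big1 ?addr0 // => m _.
  by rewrite -mulmxA hPhi bid_neq // map_mx0 mul0mx mulmx0.
elim: i => [|i [Phi [Psi [s [[hPhi hPsi hs] [cPhi cPsi] hE _]]]]].
  have [Phi hPhi aPhi] := bcycle_aug_lift F rG.
  have [Psi hPsi aPsi] := bcycle_aug_lift G rF'.
  pose E := bsub (bmul Phi Psi) (@bid (rk F 0)).
  have hE : bhom E.
    by apply: bhom_sub; [apply: bhom_mul | apply: bhom_id].
  have cE : bcycle E.
    by move=> j; rewrite map_mxB mulmxBl (augP _ _ _ _ _ aPsi) aPhi subrr.
  have [s hs Es] := bcycle_lift rF' hE cE.
  exists Phi, Psi, s; split=> [//||//|j]; last first.
  (* [Phi Psi - id] equals [s d], and [d] vanishes in k because [F] is minimal. *)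
  - have /(congr1 (fun A : blk _ _ => map_mx res (A j j))) := Es.
    rewrite map_bmul big1 => [|m _]; last by rewrite map_diffF mulmx0.
    move=> /esym/eqP; rewrite map_mxB subr_eq0 => /eqP ->.
    by rewrite bid_eq map_mx1.
  - by rewrite Es.
  split=> j.
    by rewrite (augP _ _ _ _ _ aPhi); apply: (bcycle_diff1 0 rF').
  by rewrite (augP _ _ _ _ _ aPsi); apply: (bcycle_diff1 0 rG).
have [Phi' hPhi' ePhi] := bcycle_lift rG (bhom_mul (@hdF i) hPhi) cPhi.
have [Psi' hPsi' ePsi] := bcycle_lift rF' (bhom_mul (@hdG i) hPsi) cPsi.
pose E := bsub (bmul Phi' Psi') (@bid (rk F i.+1)).
have hE' : bhom E.
  by apply: bhom_sub; [apply: bhom_mul | apply: bhom_id].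
have hds := bhom_mul (@hdF i) hs.
have Ed : bmul E (diff F i) = bmul (diff F i) (bmul s (diff F i)).
  rewrite -hE bmulBl bmulBr bmul1l bmul1r // -bmulA // ePsi bmulA // ePhi.
  by rewrite bmulA.
(* This cycle lifts to the next homotopy [s'], with [Phi' Psi' - id = d s + s' d]. *)
have cE : bcycle (bsub E (bmul (diff F i) s)).
  by move=> j l; rewrite bmulBl Ed -bmulA // /bsub subrr.
have [s' hs' es'] := bcycle_lift rF' (bhom_sub hE' hds) cE.
have ddF : forall j l, bmul (diff F i.+1) (diff F i) j l = 0.
  exact: (bcycle_diff1 i.+1 rF').
exists Phi', Psi', s'; split=> [//|||j].
- split=> j l.
    by rewrite -bmulA // ePhi bmulA // bmul0l.
  have ddG : forall j l, bmul (diff G i.+1) (diff G i) j l = 0.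
    exact: (bcycle_diff1 i.+1 rG).
  by rewrite -bmulA // ePsi bmulA // bmul0l.
- rewrite es' [in RHS]bmulBr [in RHS]bmulA //; apply: blkP => j l; rewrite /bsub.
  by rewrite [X in _ - X]bmul0l ?subr0.
have /(congr1 (fun A : blk _ _ => map_mx res (A j j))) := es'.
rewrite map_bmul big1 => [|m _]; last by rewrite map_diffF mulmx0.
move=> /esym/eqP; rewrite !map_mxB [X in _ - X]map_bmul [X in _ - X]big1 => [|m _]; last first.
  by rewrite map_diffF mul0mx.
by rewrite subr0 subr_eq0 => /eqP ->; rewrite bid_eq map_mx1.
Qed.

(** Over k, the block [j j] of [Phi Psi] is the product of the blocks [j j], as [Psi m j = 0] for
    [m < j]. So an identity matrix factors through a space of dimension [gfc_rank G i j]. *)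
Lemma minimal_rank_le i j : (rk F i j <= rk G i j)%N.
Proof.
have [Phi [Psi [s [[_ hPsi _] _ _ /(_ j)]]]] := comparison_step i.
rewrite map_bmul big_ord_recr /= big1 ?add0r => [|m _]; first exact: mulmx1_min.
by rewrite [Psi _ _](bhom_gt hPsi) // map_mx0 mulmx0.
Qed.

End Rank.

(** [F] witnesses that the resolution picked by [epsilon] is minimal. Its differential vanishes over
    k, so its homology has dimension its rank, and the ranks of two minimal resolutions bound each
    other. *)
Lemma graded_betti_rank (F : complex) i j :
    minimal_graded_free_resolution grade res F ->
  graded_betti grade res i j = rk F i j.
Proof.
move=> mF; rewrite /graded_betti; set G := resolution_of_k grade res.
have mG : minimal_graded_free_resolution grade res G.
  by apply: epsilon_spec; exists F.
have res_diff0 i' : res_diff res G i' j = 0.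
  by apply/matrixP => a b; rewrite !mxE; case: mG.
have -> : homology_dim res G i j = rk G i j.
  case: i => [|i] /=; rewrite !res_diff0 ?mxrank0 ?subn0 //.
  by rewrite mxrank_ker mxrank0 subn0.
have [[gF _] [gG _]] := (mF, mG).
by apply/eqP; rewrite eqn_leq; apply/andP; split; apply: minimal_rank_le.
Qed.

End Comparison.

(** * Letters and monomials *)

Section Letters.

Variables D e : nat.
Local Open Scope nat_scope.

(* The letter [l] is the variable of index [l]; it maps to [t ^+ tdeg l] at
   [s = 1], and [t ^+ b] lies in [R_n] iff [lam n b]. *)
Definition wt (l : nat) := if l <= D then 1 else e.
Definition tdeg (l : nat) := (wt l).-1 * D + l.
Definition lam (n b : nat) := b + n %% e <= n * D.+1.

(** Two truncated additions glued at [D]: for letters up to [D] the distances to 0 add up, for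
    letters from [D] on the distances to [D + e] add up, and both stop at [D]. Letters from opposite
    sides give [D]. *)
Definition first_letter (p q : nat) :=
  if (p <= D) && (q <= D) then minn (p + q) D
  else if (D <= p) && (D <= q) then maxn (p + q - (D + e)) D else D.

(* The pair [p q] does not occur in normal words. *)
Definition forb (p q : nat) := (p < D) && (0 < q) || (D < p) && (q < D + e).

(* Orders the letters so that [first_letter p q] precedes [p]. *)
Definition lrank (l : nat) := if l <= D then D - l else l.

Lemma lamD m n b c : lam m b -> lam n c -> lam (m + n) (b + c).
Proof.
rewrite /lam => hb hc; have : (m + n) %% e <= m %% e + n %% e.
  by rewrite -modnDm leq_mod.
nia.
Qed.

Lemma lam0 b : lam 0 b = (b == 0).
Proof. by rewrite /lam mod0n mul0n addn0 leqn0. Qed.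

Lemma lam_letter l : l <= D + e -> lam (wt l) (tdeg l).
Proof.
rewrite /lam /tdeg /wt; case: (leqP l D) => [lD _|Dl lDe] /=.
  by rewrite mul0n; have := leq_mod 1 e; lia.
by rewrite modnn; nia.
Qed.

Lemma lrank_inj p q : lrank p = lrank q -> p = q.
Proof. by rewrite /lrank; case: ifP; case: ifP; lia. Qed.

Lemma lrank_le l : l <= D + e -> lrank l <= D + e.
Proof. by rewrite /lrank; case: ifP; lia. Qed.

Lemma first_letter_le p q : p <= D + e -> q <= D + e ->
  first_letter p q <= D + e.
Proof. rewrite /first_letter; case: ifP => _; [|case: ifP => _]; lia. Qed.

Lemma first_letterA p q r : p <= D + e -> q <= D + e -> r <= D + e ->
  first_letter p (first_letter q r) = first_letter (first_letter p q) r.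
Proof.
move=> hp hq hr; rewrite /first_letter.
repeat (case: ifP); lia.
Qed.

Lemma first_letter_zero p : p <= D + e -> first_letter p D = D.
Proof. by rewrite /first_letter; repeat case: ifP; lia. Qed.

Lemma first_zero_letter q : q <= D + e -> first_letter D q = D.
Proof. by rewrite /first_letter; repeat case: ifP; lia. Qed.

Lemma lrank_first_letter p q : p <= D + e -> q <= D + e -> forb p q ->
  lrank (first_letter p q) < lrank p.
Proof.
by rewrite /first_letter /forb /lrank; repeat case: ifP; lia.
Qed.

Hypothesis e_gt0 : (0 < e)%N.

Lemma wt_gt0 l : 0 < wt l. Proof. by rewrite /wt; case: ifP. Qed.

(* The pair [(p, q)] is rewritten as [first_letter p q] times this monomial. *)
Lemma lam_first_letter p q : p <= D + e -> q <= D + e ->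
  [/\ wt (first_letter p q) < wt p + wt q,
      tdeg (first_letter p q) <= tdeg p + tdeg q
    & lam (wt p + wt q - wt (first_letter p q))
          (tdeg p + tdeg q - tdeg (first_letter p q))].
Proof.
move=> hp hq; have m2e : (e + e - 1) %% e = e - 1.
  by rewrite -addnBA // modnDl modn_small; lia.
have me := modnn e; have m1 := leq_mod 1 e.
have [hpD|hpD] := leqP p D; have [hqD|hqD] := leqP q D.
- have -> : first_letter p q = minn (p + q) D by rewrite /first_letter hpD hqD.
  by rewrite /lam /tdeg /wt hpD hqD geq_minr addnK /=; split; lia.
- have -> : first_letter p q = D by rewrite /first_letter; repeat case: ifP; lia.
  rewrite /lam /tdeg /wt hpD leqnn (_ : (q <= D) = false) /= ?addKn ?me; last by lia.
  by split=> //; case: (e) e_gt0 hq => // e' _ /= hq'; lia.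
- have -> : first_letter p q = D by rewrite /first_letter; repeat case: ifP; lia.
  rewrite /lam /tdeg /wt hqD leqnn (_ : (p <= D) = false) /= ?addnK ?me; last by lia.
  by split=> //; case: (e) e_gt0 hp => // e' _ /= hp'; lia.
have -> : first_letter p q = maxn (p + q - (D + e)) D.
  by rewrite /first_letter; repeat case: ifP; lia.
rewrite /lam /tdeg /wt [p <= D]leqNgt hpD [q <= D]leqNgt hqD /=.
case: (leqP (p + q - (D + e)) D) => hpq /=.
  (* Two letters beyond [D] with product [D] leave a monomial of weight [2e - 1], whose residue
     modulo [e] is [e - 1]. *)
  rewrite leqnn m2e.
  case: (e) e_gt0 hp hq hpq => // e' _ /= hp' hq' hpq'.
  have -> : e'.+1 + e'.+1 - 1 = e' + e'.+1 by lia.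
  by split=> //; lia.
rewrite (_ : (p + q - (D + e) <= D) = false) /= ?addnK ?me; last by lia.
by case: (e) e_gt0 hp hq hpq => // e' _ /= hp' hq' hpq'; split=> //; lia.
Qed.

(** * Divisibility of monomials by letters *)

Lemma modn_pred m : 0 < m %% e -> (m - 1) %% e = m %% e - 1.
Proof.
move=> h; rewrite {1}(divn_eq m e) -addnBA // modnMDl modn_small //.
by have := ltn_pmod m e_gt0; lia.
Qed.

Lemma modn_sube m : e <= m -> (m - e) %% e = m %% e.
Proof. by move=> em; rewrite -[in RHS](subnK em) modnDr. Qed.

Lemma modn_gap m : m %% e + e <= m \/ m %% e = m.
Proof.
case: (leqP e m) => h; last by right; apply: modn_small.
left; rewrite -modn_sube //; have := leq_mod (m - e) e; lia.
Qed.

(** Divisibility inside the monoid of monomials of R: the quotient must satisfy [lam] again. *)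
Definition divides_by l m b :=
  [&& wt l <= m, tdeg l <= b & lam (m - wt l) (b - tdeg l)].

Lemma divides_pos m b : 0 < m -> 0 < b -> b <= m * D ->
  exists2 l, 0 < l <= D & divides_by l m b.
Proof.
(* The letter takes as much of [b] as possible, so that at most [(m - 1) * D] remains. *)
move=> m0 b0 bmD; exists (minn b D); first by nia.
rewrite /divides_by /lam /tdeg /wt geq_minr /= mul0n add0n geq_minl m0 /=.
have := leq_mod (m - 1) e; nia.
Qed.

Lemma divides_0 m : 0 < m -> divides_by 0 m 0.
Proof.
move=> m0; rewrite /divides_by /lam /tdeg /wt /= m0 /= sub0n add0n.
by rewrite (leq_trans (leq_mod _ _)) // leq_pmulr.
Qed.

(** Call [b - m * D] the excess; [lam m b] says that the excess plus [m %% e] is at most [m].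
    Removing the letter [D + g] lowers the excess by [g] and the weight by [e], which keeps
    [m %% e]; the last hypothesis is this bound for the quotient. *)
Lemma divides_neg m b g : lam m b -> m * D < b -> 0 < g <= e ->
    g <= b - m * D -> b - m * D - g + e + m %% e <= m ->
  divides_by (D + g) m b.
Proof.
rewrite /lam => h mDb /andP[g0 ge] gb hg.
have em : e <= m by lia.
have hmod := modn_sube em.
have -> : divides_by (D + g) m b = 
   [&& e <= m, e.-1 * D + (D + g) <= b &
     b - (e.-1 * D + (D + g)) + (m - e) %% e <= (m - e) * D.+1].
  by rewrite /divides_by /lam /tdeg /wt; have -> : (D + g <= D) = false by lia.
rewrite em hmod /=.
have e1D : e.-1 * D + D = e * D by rewrite -mulSnr prednK.
have : (m - e) * D = m * D - e * D by rewrite mulnBl.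
have : (m - e) * D.+1 = (m - e) * D + (m - e) by rewrite mulnS addnC.
have : m * D.+1 = m * D + m by rewrite mulnS addnC.
have : e * D <= m * D by rewrite leq_mul2r em orbT.
lia.
Qed.

Lemma divides_negE m b : lam m b -> m * D < b ->
  exists2 l, D < l <= D + e & divides_by l m b.
Proof.
move=> h Db; have := h; rewrite /lam mulnS => h'.
exists (D + minn (b - m * D) e); first by lia.
by apply: divides_neg => //; have := modn_gap m; lia.
Qed.

Lemma divides_letter m b : 0 < m -> lam m b ->
  exists2 l, l <= D + e & divides_by l m b.
Proof.
move=> m0 h; have [->|b0] := posnP b; first by exists 0; rewrite ?divides_0.
have [bD|Db] := leqP b (m * D).
  by have [l lD hl] := divides_pos m0 b0 bD; exists l => //; lia.
by have [l lD hl] := divides_negE h Db; exists l => //; lia.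
Qed.

(** If no letter dividing the monomial could follow [l] in a forbidden pair, then [l] followed by
    the normal word of the monomial would be normal, and [l] would be the least divisor of the
    product. *)
Lemma divides_forb l l' m b : l <= D + e -> lam m b ->
    lrank l' < lrank l -> divides_by l' (m + wt l) (b + tdeg l) ->
  exists2 l'', l'' <= D + e & forb l l'' && divides_by l'' m b.
Proof.
move=> hl hmb; case: (leqP l D) => [lD|Dl].
  rewrite {1 2}/lrank lD; case: ifP => [l'D|]; last by lia.
  move=> ltl; rewrite {1}/divides_by /tdeg /wt lD l'D /= !mul0n !add0n.
  case/and3P => _ l'b _; have b0 : 0 < b by lia.
  have m0 : 0 < m.
    by rewrite lt0n; apply/negP => /eqP m0; move: hmb; rewrite m0 lam0; lia.
  have [bD|Db] := leqP b (m * D).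
    have [x xD hx] := divides_pos m0 b0 bD; exists x; first by lia.
    by rewrite hx andbT /forb; lia.
  have [x xD hx] := divides_negE hmb Db; exists x; first by lia.
  by rewrite hx andbT /forb; lia.
(* After a letter beyond [D] every letter but [D + e] is forbidden, so the aim is a divisor other
   than [D + e]. *)
have lD : (l <= D) = false by lia.
move=> rl' /and3P[w1 w2 w3].
have [bD|Db] := leqP b (m * D).
  have [m0|m0] := posnP m.
    exfalso; move: bD hmb w1 w2 w3 rl'.
    rewrite m0 add0n mul0n leqn0 => /eqP->; rewrite add0n /lam /lrank.
    rewrite /tdeg /wt lD /=.
    case: (leqP l' D) => l'D /= _.
      rewrite mul0n add0n; have -> : (e - 1) %% e = e - 1.
        by rewrite modn_small //; lia.
      by case: (e) e_gt0 => // e' _ /=; lia.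
    by rewrite subnn; lia.
  have [b0|b0] := posnP b.
    by exists 0 => //; rewrite b0 divides_0 // /forb Dl; lia.
  have [x xD hx] := divides_pos m0 b0 bD; exists x; first by lia.
  by rewrite hx andbT /forb; lia.
have h := hmb; rewrite /lam mulnS in h.
(* If [m %% e] is positive, removing [D] lowers both [m] and [m %% e] by 1 and keeps the excess, so
   [D] divides. *)
have [m0|mm0] := posnP (m %% e); last first.
  exists D; first by lia.
  rewrite /forb Dl /= ?orbT; apply/andP; split; first by lia.
  have hm := modn_pred mm0.
  rewrite /divides_by /tdeg /wt /lam leqnn hm /= mul0n add0n.
  have := leq_mod m e; nia.
have gap := modn_gap m.
have [bm|bm] := ltnP (b - m * D) m.
  have [e1|e1] := leqP e 1.
    have e1' : e = 1 by lia.
    exists D; first by lia.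
    rewrite /forb Dl /= ?orbT; apply/andP; split; first by lia.
    rewrite /divides_by /tdeg /wt /lam leqnn /= mul0n add0n e1' modn1.
    nia.
  (* Stopping at [e - 1] avoids [D + e]; the quotient stays in R because the excess is less than
     [m]. *)
  exists (D + minn (b - m * D) e.-1); first by lia.
  apply/andP; split; first by rewrite /forb; lia.
  apply: divides_neg => //; lia.
(* The monomial is now a power of the letter [D + e], and no letter before [l] divides its product
   with [l]. *)
exfalso; have bE : b = m * D + m by lia.
move: w1 w2 w3 rl'; rewrite bE /lam /lrank /tdeg /wt lD /=.
case: (leqP l' D) => l'D /= _.
  rewrite mul0n add0n; have -> : (m + e - 1) %% e = e - 1.
    by rewrite -addnBA // -modnDml m0 add0n modn_small //; lia.
  case: (e) e_gt0 => // e' _ /=; rewrite !mulnS subn1 /= -addnBA; nia.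
rewrite addnK m0; nia.
Qed.

End Letters.

(** * Words and their faces *)

Section Words.

Variables D e : nat.
Hypothesis e_gt0 : (0 < e)%N.
Local Open Scope nat_scope.

Local Notation fl := (first_letter D e).
Local Notation letter := (fun l => l <= D + e).
Local Notation forb := (forb D e).

(* Words are stored in reverse: the head of the sequence is the last letter. *)
Fixpoint merge_at k (w : seq nat) :=
  match k, w with
  | 0, q :: p :: w' => fl p q :: w'
  | k'.+1, q :: w' => q :: merge_at k' w'
  | _, _ => w
  end.

(** These are the faces of the bar construction for the product [first_letter], without the one that
    drops the first letter. *)
Definition face k w := if k is k'.+1 then merge_at k' w else behead w.

Definition weight w := sumn (map (wt D e) w).
Definition wdeg w := sumn (map (tdeg D e) w).
(** A numeral in base [D + e + 1] with digits [lrank]. The first letter is the most significant, so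
    words of equal length are ordered lexicographically. *)
Definition key w := foldr (fun l n => lrank D l + (D + e).+1 * n) 0 w.

Definition is_chain w := all letter w && sorted (fun q p => forb p q) w.

Definition nexts (w : seq nat) :=
  [seq q <- iota 0 (D + e).+1 | if w is p :: _ then forb p q else true].

Fixpoint chains i : seq (seq nat) :=
  if i is i'.+1 then [seq q :: w | w <- chains i', q <- nexts w] else [:: [::]].

Definition incidence (A : pzRingType) (v w : seq nat) : A :=
  (\sum_(k < size v) (-1) ^+ k * (face k v == w)%:R)%R.

Lemma mem_nexts w q : (q \in nexts w) =
  (q <= D + e) && (if w is p :: _ then forb p q else true).
Proof. by rewrite mem_filter mem_iota add0n ltnS andbC. Qed.

Lemma is_chain_cons q w : is_chain (q :: w) = is_chain w && (q \in nexts w).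
Proof.
rewrite mem_nexts /is_chain; case: w => [|p w] /=; first by rewrite !andbT.
case: (_ <= _); case: (_ <= _); case: (forb p q); case: (all _ _) => //=;
by rewrite ?andbT ?andbF.
Qed.

Lemma mem_chains i w : (w \in chains i) = (size w == i) && is_chain w.
Proof.
elim: i w => [|i IHi] w /=.
  by rewrite inE -size_eq0; case: w.
apply/allpairsPdep/idP => [[x [q [+ qx ->]]]|].
  by rewrite IHi is_chain_cons /= eqSS => /andP[-> ->].
case: w => [//|q w]; rewrite eqSS is_chain_cons => /and3P[sw cw qw].
by exists w, q; split=> //; rewrite IHi sw.
Qed.

Lemma uniq_chains i : uniq (chains i).
Proof.
elim: i => [//|i IHi]; apply: allpairs_uniq_dep => //.
  by move=> w _; rewrite filter_uniq // iota_uniq.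
by move=> [x p] [y q] _ _ [-> ->].
Qed.

Lemma sum_chainsS (A : nmodType) i (F : seq nat -> A) :
  (\sum_(v <- chains i.+1) F v =
   \sum_(w <- chains i) \sum_(q <- nexts w) F (q :: w))%R.
Proof. exact: big_allpairs_dep. Qed.

(** * Simplicial identities and the square of the differential *)

Lemma size_merge k w : k.+1 < size w -> size (merge_at k w) = (size w).-1.
Proof.
elim: k w => [|k IHk] [|q w] //=; first by case: w.
by rewrite ltnS => kw; rewrite IHk //; case: w kw.
Qed.

Lemma size_face k w : k < size w -> size (face k w) = (size w).-1.
Proof. by case: k => [|k] kw; rewrite ?size_behead ?size_merge. Qed.

Lemma all_merge k w : all letter w -> all letter (merge_at k w).
Proof.
elim: k w => [|k IHk] [|q w] //=; last by case/andP=> -> /IHk.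
by case: w => [//|p w] /= /and3P[qD pD ->]; rewrite first_letter_le.
Qed.

(** Disjoint merges commute; for [j = k] the merges overlap, and this is the associativity of
    [first_letter]. *)
Lemma merge_merge j k w : all letter w -> j <= k -> k.+2 < size w ->
  merge_at j (merge_at k.+1 w) = merge_at k (merge_at j w).
Proof.
elim: j k w => [|j IHj] k [|q w] //=.
  case: k w => [|k] [|p w] //= /and3P[hq hp hw] _ kw.
  by case: w hw kw => [//|r w] /= /andP[hr hw] _; rewrite first_letterA.
by case/andP=> _ hw; case: k => // k jk kw; rewrite [RHS]/= -IHj.
Qed.

Lemma face_face j k w : all letter w -> j <= k -> k.+1 < size w ->
  face j (face k.+1 w) = face k (face j w).
Proof.
case: j => [|j] hw; last first.
  by case: k => // k jk kw; rewrite /face merge_merge.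
by case: k w hw => [|k] [|q [|p w]].
Qed.

(** The terms [(k + 1, j)] and [(j, k)] with [j <= k] have opposite signs and cancel. *)
Lemma alternating_sum_eq0 (A : pzRingType) n (G : nat -> nat -> A) :
    (forall j k, j <= k -> k <= n -> G k.+1 j = G j k) ->
  (\sum_(k < n.+2) \sum_(j < n.+1) (-1) ^+ k * (-1) ^+ j * G k j = 0)%R.
Proof.
move=> GE; pose F k j : A := ((-1) ^+ k * (-1) ^+ j * G k j)%R.
have FE j k : j <= k -> k <= n -> F k.+1 j = (- F j k)%R.
  by move=> jk kn; rewrite /F GE // exprS !mulN1r !mulNr -!exprD addnC.
transitivity (\sum_(j < n.+1) \sum_(k < n.+1)
  ((if (j <= k)%N then F k.+1 j else 0) + (if (j <= k)%N then F j k else 0)))%R; last first.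
  rewrite big1 // => j _; rewrite big1 // => k _; case: ifP => jk; last exact: addr0.
  by rewrite FE ?addNr // -ltnS.
under [RHS]eq_bigr => j _ do rewrite big_split.
rewrite big_split /= [X in (X + _)%R]exchange_big /=.
transitivity (\sum_(k < n.+2) \sum_(j < n.+1) (if (j < k)%N then F k j else 0) +
              \sum_(k < n.+2) \sum_(j < n.+1) (if (k <= j)%N then F k j else 0))%R.
  rewrite -big_split /=; apply: eq_bigr => k _.
  rewrite -big_split /=; apply: eq_bigr => j _.
  by case: ltnP => _; rewrite ?addr0 ?add0r.
congr (_ + _)%R.
  by rewrite big_ord_recl /= big1 // add0r.
rewrite big_ord_recr /= [X in (_ + X)%R]big1 ?addr0 // => j _.
by rewrite leqNgt ltn_ord.
Qed.

Lemma mem_merge_zero k w : all letter w -> D \in w -> D \in merge_at k w.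
Proof.
elim: k w => [|k IHk] [|q w] //=.
  case: w => [//|p w] /= /and3P[hq hp _]; rewrite !inE => /or3P[/eqP<-|/eqP<-|->].
  - by rewrite first_letter_zero // eqxx.
  - by rewrite first_zero_letter // eqxx.
  - by rewrite orbT.
case/andP=> _ hw; rewrite !inE => /orP[->//|/(IHk _ hw) ->]; exact: orbT.
Qed.

(* The words with a letter [D] beyond their head span a subcomplex, since the
   first two faces of [b :: D :: w] coincide. *)
Lemma incidence_zero (A : pzRingType) v w : all letter v -> D \in behead v ->
  D \notin behead w -> incidence A v w = 0%R.
Proof.
case: v => [//|b [//|p v]] /= /and3P[hb hp hv] Dv Dw.
have tail0 k : (face k.+2 [:: b, p & v] == w) = false.
  apply: contraNF Dw => /eqP <-; rewrite [behead _]/=.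
  by apply: mem_merge_zero => //=; rewrite hp.
rewrite /incidence /= !big_ord_recl /= big1 => [|k _]; last first.
  case: eqP => [fk|_]; last by rewrite mulr0.
  by have /eqP[] := tail0 k; apply: fk.
rewrite addr0 expr0 mul1r expr1 mulN1r.
have [pD|pD] := eqVneq p D.
  by rewrite pD first_zero_letter // subrr.
move: Dv; rewrite inE eq_sym (negPf pD) /= => Dv.
have -> : (p :: v == w) = false by apply: contraNF Dw => /eqP <-.
have -> : (fl p b :: v == w) = false by apply: contraNF Dw => /eqP <-.
by rewrite subrr.
Qed.

(* [forb] without the requirement [p != D], so that faces preserve it. *)
Definition weak_forb p q := ((p < D) ==> (0 < q)) && ((D < p) ==> (q < D + e)).

Lemma forbE p q : forb p q = (p != D) && weak_forb p q.
Proof. by rewrite /forb /weak_forb; case: ltngtP. Qed.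

Lemma path_merge k x w : all letter w -> k.+1 < size w ->
    path (fun q p => weak_forb p q) x w ->
  path (fun q p => weak_forb p q) x (merge_at k w).
Proof.
elim: k x w => [|k IHk] x [|q w] //=.
  case: w => [//|p [|r w]] /= /and3P[hq hp hw] _.
    rewrite !andbT; rewrite /weak_forb /first_letter.
    by repeat case: ifP; lia.
  case/and4P=> h1 h2 h3 ->; rewrite andbT.
  move: h1 h2 h3; rewrite /weak_forb /first_letter.
  by repeat case: ifP; lia.
by case/andP=> _ hw kw /andP[-> /IHk]; apply.
Qed.

Lemma sorted_merge k w : all letter w -> k.+1 < size w ->
    sorted (fun q p => weak_forb p q) w ->
  sorted (fun q p => weak_forb p q) (merge_at k w).
Proof.
case: k w => [|k] [|q w] //=; last first.
  by case/andP=> _ hw kw; apply: path_merge.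
case: w => [//|p [|r w]] //= /and4P[hq hp hr hw] _ /and3P[h1 h2 ->].
rewrite andbT; move: h1 h2; rewrite /weak_forb /first_letter.
by repeat case: ifP; lia.
Qed.

(** Chains are thus the weakly forbidden words in which [D] occurs at most as the last letter,
    stored at the head. *)
Lemma sorted_forb w : sorted (fun q p => forb p q) w =
  sorted (fun q p => weak_forb p q) w && (D \notin behead w).
Proof.
case: w => //= q w; elim: w q => [//|p w IHw] q /=.
rewrite IHw forbE inE negb_or [D == p]eq_sym.
by case: (p == D); rewrite ?andbF //= andbA.
Qed.

Lemma is_chain_letters w : is_chain w -> all letter w.
Proof. by case/andP. Qed.

Lemma is_chain_zero w : is_chain w -> D \notin behead w.
Proof. by case/andP=> _; rewrite sorted_forb => /andP[]. Qed.

Lemma is_chain_face k v : is_chain v -> k < size v ->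
  D \notin behead (face k v) -> is_chain (face k v).
Proof.
case/andP=> hv; rewrite /is_chain !sorted_forb => /andP[sv Dv] kv ->.
rewrite andbT; apply/andP; split; case: k kv => [|k] kv /=.
- by case: v hv {sv Dv kv} => //= q v /andP[].
- exact: all_merge.
- by case: v sv {hv Dv kv} => //= q v /path_sorted.
- exact: sorted_merge.
Qed.

(** A face of a chain fails to be a chain only by having [D] beyond its head, where [F] vanishes; so
    the sum may run over all faces. *)
Lemma sum_incidence (A : pzRingType) i v (F : seq nat -> A) :
    v \in chains i.+1 ->
    (forall w, all letter w -> D \in behead w -> F w = 0%R) ->
  (\sum_(w <- chains i) incidence A v w * F w =
   \sum_(k < i.+1) (-1) ^+ k * F (face k v))%R.
Proof.
rewrite mem_chains => /andP[/eqP sv cv] F0.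
under eq_bigr => w _ do rewrite /incidence sv mulr_suml.
rewrite exchange_big /=; apply: eq_bigr => k _.
have kv : k < size v by rewrite sv.
under eq_bigr => w _ do rewrite -mulrA; rewrite -mulr_sumr; congr (_ * _)%R.
have [Dk|Dk] := boolP (D \in behead (face k v)); last first.
  have fk : face k v \in chains i.
    by rewrite mem_chains size_face // sv eqxx is_chain_face.
  rewrite (bigD1_seq _ fk) ?uniq_chains //= eqxx mul1r big1 ?addr0 // => w.
  by rewrite eq_sym => /negPf->; rewrite mul0r.
rewrite F0 //; last first.
  case: (k : nat) => [|k'] /=; last exact/all_merge/is_chain_letters.
  by case: v cv {sv kv Dk} => //= q v /is_chain_letters /andP[].
rewrite big_seq big1 // => w; rewrite mem_chains => /andP[_ cw].
case: eqP => [fw|]; last by rewrite mul0r.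
by move: (is_chain_zero cw); rewrite -fw Dk.
Qed.

(** By [incidence_zero] the faces that are not chains contribute nothing, so the sum extends to all
    iterated faces, which cancel in pairs. *)
Lemma incidence_incidence (A : pzRingType) i v x :
    v \in chains i.+2 -> x \in chains i ->
  (\sum_(w <- chains i.+1) incidence A v w * incidence A w x = 0)%R.
Proof.
move=> vi xi; have := vi; have := xi.
rewrite !mem_chains => /andP[_ cx] /andP[/eqP sv cv].
rewrite (sum_incidence vi) => [|w hw Dw]; last first.
  by rewrite incidence_zero ?is_chain_zero.
rewrite -[RHS](@alternating_sum_eq0 A i (fun k j => (face j (face k v) == x)%:R)%R).
  apply: eq_bigr => k _; rewrite /incidence size_face ?sv // mulr_sumr.
  by apply: eq_bigr => j _; rewrite mulrA.
move=> j k jk ki; rewrite face_face ?is_chain_letters // sv; lia.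
Qed.

(** * Leading terms of boundaries and degrees of faces *)

(** The two words agree before the merged pair. There [first_letter p q] replaces [p] and has lower
    rank; all later letters are less significant digits. *)
Lemma key_merge k v : is_chain v -> k.+1 < size v ->
  key (merge_at k v) < key (behead v).
Proof.
elim: k v => [|k IHk] [|q [|p w]] //=.
  rewrite is_chain_cons mem_nexts => /and3P[+ hq pq] _.
  rewrite is_chain_cons mem_nexts => /and3P[_ hp _].
  by rewrite ltn_add2r lrank_first_letter.
rewrite is_chain_cons mem_nexts => /and3P[cw hq _] kw.
have /IHk /(_ kw) /= := cw; have := lrank_le hq.
by rewrite -/(key w); nia.
Qed.

Lemma incidence_neq0 (A : pzRingType) v w : incidence A v w != 0%R ->
  exists2 k, k < size v & face k v = w.
Proof.
have [/existsP[k /eqP fk] _|/existsPn nface] :=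
    boolP [exists k : 'I_(size v), face k v == w]; first by exists k.
rewrite /incidence big1 ?eqxx // => k _.
by rewrite (negPf (nface k)) mulr0.
Qed.

(** The leading word of the boundary of [q :: w] is therefore [w]. *)
Lemma incidence_key (A : pzRingType) q w x : is_chain (q :: w) ->
  incidence A (q :: w) x != 0%R -> x = w \/ key x < key w.
Proof.
move=> cv /incidence_neq0[[|k] kv <-]; first by left.
by right; apply: key_merge.
Qed.

Lemma incidence_behead (A : pzRingType) q w : is_chain (q :: w) ->
  incidence A (q :: w) w = 1%R.
Proof.
move=> cv; rewrite /incidence big_ord_recl /= eqxx mulr1 big1 ?addr0 // => k _.
have kv : k.+1 < size (q :: w) by rewrite /= ltnS.
have := key_merge cv kv; rewrite /= /bump add1n.
by case: eqP => [->|_]; rewrite ?ltnn ?mulr0.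
Qed.

(** The differential thus has monomials of R of positive degree as coefficients, whence homogeneity
    and minimality. *)
Lemma weight_face k v : all letter v -> k < size v ->
  [/\ weight (face k v) < weight v, wdeg (face k v) <= wdeg v
    & lam D e (weight v - weight (face k v)) (wdeg v - wdeg (face k v))].
Proof.
case: k => [|k]; first case: v => [//|q v] /= /andP[hq _] _.
  have := lam_letter hq; have := wt_gt0 D e_gt0 q.
  by rewrite /weight /wdeg /= !addnK leq_addl -[X in X < _ + _]add0n ltn_add2r.
rewrite /face; elim: k v => [|k IHk] [|q [|p w]] //=.
  move=> /and3P[hq hp _] _; have [h1 h2 h3] := lam_first_letter e_gt0 hp hq.
  rewrite /weight /wdeg /=; move: h1 h2 h3.
  move: (wt _ _ _) (wt _ _ _) (wt _ _ _) (tdeg _ _ _) (tdeg _ _ _) (tdeg _ _ _).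
  move=> a b c a' b' c'; rewrite !addnA !subnDr [b + a]addnC [b' + a']addnC.
  by rewrite ltn_add2r leq_add2r.
move=> /andP[hq hw] kw; have [h1 h2 h3] := IHk (p :: w) hw kw.
by rewrite /weight /wdeg /= !subnDl ltn_add2l leq_add2l.
Qed.

End Words.

Arguments chains : simpl never.

(** * The coordinate ring *)

Local Open Scope quotient_scope.

Section CoordinateRing.

Variables (k : fieldType) (D e : nat).
Hypothesis e_gt0 : (0 < e)%N.

Local Notation d := D.+1.
Local Notation S := {mpoly k[d + e]}.
Local Notation R := (wrc_ring k d e).
Local Notation grade := (@wrc_homog k d e).

Definition mnm_tdeg (m : 'X_{1..d + e}) := (\sum_(i < d + e) tdeg D e i * m i)%N.

Lemma wrc_weightE (m : 'X_{1..d + e}) :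
  wrc_weight m = (\sum_(i < d + e) wt D e i * m i)%N.
Proof. by []. Qed.

Lemma wrc_varE (i : 'I_(d + e)) :
  wrc_var k i = st_monomial k (d * wt D e i - tdeg D e i) (tdeg D e i).
Proof.
rewrite /wrc_var /tdeg /wt; case: splitP => j ij; rewrite ij.
  have -> : (j <= D)%N by rewrite -ltnS ltn_ord.
  by rewrite /= muln1 mul0n.
have -> : (d + j <= D)%N = false by rewrite leqNgt ltnS leq_addr.
move: (nat_of_ord j) (ltn_ord j) => n; case: (e) e_gt0 => // e' _ /= nE.
by congr st_monomial; lia.
Qed.

Lemma wrc_map_monomial (m : 'X_{1..d + e}) : wrc_map ('X_[m] : S) =
  st_monomial k (d * wrc_weight m - mnm_tdeg m) (mnm_tdeg m).
Proof.
rewrite /wrc_map comp_mpolyX /mnm_tdeg wrc_weightE big_distrr /=.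
pose st := fun s t => st_monomial k s t.
have le_tdeg (i : 'I_(d + e)) : (tdeg D e i <= d * wt D e i)%N.
  have := lam_letter (_ : i <= D + e)%N; rewrite /lam -ltnS ltn_ord.
  by rewrite mulnC => /(_ isT); apply: leq_trans; rewrite leq_addr.
transitivity (st (\sum_(i < d + e) (d * wt D e i - tdeg D e i) * m i)%N
                 (\sum_(i < d + e) tdeg D e i * m i)%N).
  rewrite /st /st_monomial !expr_sum -big_split /=.
  apply: eq_bigr => i _; rewrite tnth_mktuple wrc_varE /st_monomial exprMn_comm.
    by rewrite -!exprM.
  exact: mulrC.
rewrite /st; congr st_monomial; rewrite -sumnB => [|i _].
  by apply: eq_bigr => i _; rewrite mulnBl mulnA.
by rewrite mulnA leq_mul2r le_tdeg orbT.
Qed.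

Lemma lam_mnm (m : 'X_{1..d + e}) : lam D e (wrc_weight m) (mnm_tdeg m).
Proof.
rewrite wrc_weightE /mnm_tdeg.
apply: (big_ind2 (fun n b => lam D e n b)) => [||i _]; first by rewrite lam0.
  by move=> n b n' b'; apply: lamD.
elim: (m i) => [|c IHc]; first by rewrite !muln0 lam0.
by rewrite !mulnS; apply: lamD => //; apply: lam_letter => //; rewrite -ltnS.
Qed.

(** By induction on the weight, splitting off a letter with [divides_letter]. With [lam_mnm] this
    determines the monomials of R. *)
Lemma mnm_of_lam n b : lam D e n b ->
  exists m : 'X_{1..d + e}, wrc_weight m = n /\ mnm_tdeg m = b.
Proof.
elim/ltn_ind: n b => n IHn b nb.
have [n0|n_gt0] := posnP n.
  exists 0%MM; move: nb; rewrite n0 lam0 => /eqP ->; rewrite wrc_weight0; split=> //.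
  by rewrite /mnm_tdeg big1 // => i _; rewrite mnm0E muln0.
have [l lD /and3P[wl tl /IHn]] := divides_letter e_gt0 n_gt0 nb.
have wl0 := wt_gt0 D e_gt0 l.
rewrite ltn_subrL wl0 n_gt0 => /(_ isT)[m [wm tm]].
have lt_l : (l < d + e)%N by rewrite addSn ltnS.
exists (m + U_(Ordinal lt_l))%MM; rewrite wrc_weightD wm wrc_weightE.
have tD m1 m2 : mnm_tdeg (m1 + m2)%MM = (mnm_tdeg m1 + mnm_tdeg m2)%N.
  by rewrite /mnm_tdeg -big_split; apply: eq_bigr => i _; rewrite mnmDE mulnDr.
have sumU (F : nat -> nat) :
    (\sum_(i < d + e) F i * U_(Ordinal lt_l)%MM i = F l)%N.
  rewrite (bigD1 (Ordinal lt_l)) //= mnm1E eqxx muln1 big1 ?addn0 // => i.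
  by rewrite mnm1E eq_sym => /negPf ->; rewrite muln0.
by rewrite tD tm /mnm_tdeg !sumU !subnK.
Qed.

(* The dehomogenisation [s = 1] of the monomial parametrisation; it is
   injective on each graded component of [R]. *)
Definition dehom0 (p : S) : {poly k} :=
  mmap polyC (fun i : 'I_2 => if i == ord0 then 1 else 'X) (wrc_map p).

Definition dehom (r : R) : {poly k} := dehom0 (repr (r : {ideal_quot _})).

Fact wrc_map_is_linear : linear (@wrc_map k d e).
Proof. by move=> c p q; rewrite /wrc_map comp_mpolyD comp_mpolyZ. Qed.

HB.instance Definition _ := GRing.isLinear.Build k S {mpoly k[2]} _ (@wrc_map k d e)
  wrc_map_is_linear.

Fact dehom0_is_linear : linear dehom0.
Proof.
by move=> c p q; rewrite /dehom0 linearP mmapD mmapZ mul_polyC.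
Qed.

HB.instance Definition _ := GRing.isLinear.Build k S {poly k} _ dehom0
  dehom0_is_linear.

Lemma wrc_piB : {morph @wrc_pi k d e : p q / p - q}.
Proof. by move=> p q; rewrite /wrc_pi rmorphB. Qed.

Lemma wrc_piM : {morph @wrc_pi k d e : p q / p * q}.
Proof. by move=> p q; rewrite /wrc_pi rmorphM. Qed.

Lemma wrc_pi1 : @wrc_pi k d e 1 = 1.
Proof. by rewrite /wrc_pi rmorph1. Qed.

Lemma wrc_piP (r : R) : exists p, r = wrc_pi p.
Proof. by exists (repr (r : {ideal_quot _})); rewrite /wrc_pi reprK. Qed.

Lemma wrc_pi_eq0 (p : S) : wrc_map p = 0 -> wrc_pi p = 0.
Proof.
move=> p0; have : p - 0 \in @wrc_ideal k d e.
  by rewrite subr0; apply/eqP.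
by rewrite Quotient.idealrBE => /eqP eq_p0; rewrite /wrc_pi eq_p0 rmorph0.
Qed.

Lemma dehom_pi p : dehom (wrc_pi p) = dehom0 p.
Proof.
rewrite /dehom /dehom0; congr mmap; apply/eqP; rewrite -subr_eq0 -linearB.
have : (repr (\pi_{ideal_quot (@wrc_ideal k d e)} p) - p) \in @wrc_ideal k d e.
  by rewrite Quotient.idealrBE reprK.
by [].
Qed.

Lemma dehom0M : {morph dehom0 : p q / p * q}.
Proof. by move=> p q; rewrite /dehom0 /wrc_map !rmorphM. Qed.

Fact dehom_is_zmod_morphism : zmod_morphism dehom.
Proof.
move=> r s; have [p ->] := wrc_piP r; have [q ->] := wrc_piP s.
by rewrite -wrc_piB !dehom_pi linearB.
Qed.

Fact dehom_is_monoid_morphism : monoid_morphism dehom.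
Proof.
split=> [|r s]; first by rewrite -wrc_pi1 dehom_pi /dehom0 /wrc_map !rmorph1.
have [p ->] := wrc_piP r; have [q ->] := wrc_piP s.
by rewrite -wrc_piM !dehom_pi dehom0M.
Qed.

HB.instance Definition _ :=
  GRing.isZmodMorphism.Build R {poly k} dehom dehom_is_zmod_morphism.
HB.instance Definition _ :=
  GRing.isMonoidMorphism.Build R {poly k} dehom dehom_is_monoid_morphism.

Lemma dehom0_monomial m : dehom0 'X_[m] = 'X^(mnm_tdeg m).
Proof.
rewrite /dehom0 wrc_map_monomial /st_monomial rmorphM !rmorphXn /=.
by rewrite !mmapX !mmap1U /= expr1n mul1r.
Qed.

Lemma dehom0E p : dehom0 p = \sum_(m <- msupp p) p@_m *: 'X^(mnm_tdeg m).
Proof.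
rewrite {1}[p]mpolyE linear_sum; apply: eq_bigr => m _.
by rewrite linearZ /= dehom0_monomial.
Qed.

Lemma dehom_grade n r b : grade n r -> (dehom r)`_b != 0 -> lam D e n b.
Proof.
case=> p /dhomogP hp ->; rewrite dehom_pi dehom0E coef_sum.
apply: contraR => nlam; rewrite big_seq big1 // => m /hp wm.
rewrite coefZ coefXn; case: eqP => [bm|_]; last by rewrite mulr0.
by move: nlam; rewrite bm -wm lam_mnm.
Qed.

(** In degree [n] the exponent of t is some [b] and that of s is [d * n - b], so [wrc_map p] can be
    recovered from its value at s = 1. *)
Lemma dehom_inj n r : grade n r -> dehom r = 0 -> r = 0.
Proof.
case=> p /dhomogP hp ->; rewrite dehom_pi => p0; apply: wrc_pi_eq0.
pose N := (n * d).+1.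
transitivity (\sum_(b < N) (dehom0 p)`_b *: st_monomial k (d * n - b) b); last first.
  by rewrite big1 // => b _; rewrite p0 coef0 scale0r.
under eq_bigr => b _ do rewrite dehom0E coef_sum scaler_suml.
rewrite exchange_big /= {1}[p]mpolyE linear_sum.
rewrite big_seq [RHS]big_seq; apply: eq_bigr => m /hp wm.
have lt_tdeg : (mnm_tdeg m < N)%N.
  by rewrite ltnS -wm; apply: leq_trans (lam_mnm m); rewrite leq_addr.
rewrite (bigD1 (Ordinal lt_tdeg)) //= big1 ?addr0 => [|b bm].
  by rewrite coefZ coefXn eqxx mulr1 -wm -wrc_map_monomial linearZ.
rewrite coefZ coefXn; case: eqP => [bE|_]; last by rewrite mulr0 scale0r.
by case/eqP: bm; apply: val_inj.
Qed.

Lemma dehom_surj n (q : {poly k}) : (forall b, q`_b != 0 -> lam D e n b) ->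
  exists2 r, grade n r & dehom r = q.
Proof.
move=> hq; have inh : inhabited 'X_{1..d + e} by exists; exact: 0%MM.
pose P b m := wrc_weight m = n /\ mnm_tdeg m = b.
pose m_ b := epsilon inh (P b).
have m_P b : q`_b != 0 -> P b (m_ b).
  by move=> /hq/mnm_of_lam [m Pm]; apply: (epsilon_spec inh (P b)); exists m.
exists (wrc_pi (\sum_(b < size q) q`_b *: 'X_[m_ b])).
  exists (\sum_(b < size q) q`_b *: 'X_[m_ b]) => //.
  apply: rpred_sum => b _; have [->|qb] := eqVneq q`_b 0.
    by rewrite scale0r rpred0.
  by apply: rpredZ; rewrite dhomogX; case: (m_P b qb) => /eqP.
rewrite dehom_pi -[RHS]coefK poly_def linear_sum; apply: eq_bigr => b _.
have [->|qb] := eqVneq q`_b 0; first by rewrite !scale0r linear0.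
by have [_ tb] := m_P b qb; rewrite linearZ /= dehom0_monomial tb.
Qed.

Fact wrc_res_is_zmod_morphism : zmod_morphism (@wrc_res k d e).
Proof.
move=> r s; have [p ->] := wrc_piP r; have [q ->] := wrc_piP s.
by rewrite -wrc_piB !wrc_resE // mcoeffB.
Qed.

Fact wrc_res_is_monoid_morphism : monoid_morphism (@wrc_res k d e).
Proof.
split=> [|r s]; first by rewrite -wrc_pi1 wrc_resE // mcoeff1 eqxx.
have [p ->] := wrc_piP r; have [q ->] := wrc_piP s.
by rewrite -wrc_piM !wrc_resE // -rmorphM.
Qed.

HB.instance Definition _ := GRing.isZmodMorphism.Build R k (@wrc_res k d e)
  wrc_res_is_zmod_morphism.
HB.instance Definition _ := GRing.isMonoidMorphism.Build R k (@wrc_res k d e)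
  wrc_res_is_monoid_morphism.

Lemma grade0 n : grade n 0.
Proof. by exists 0; [apply: dhomog0 | rewrite /wrc_pi rmorph0]. Qed.

Lemma gradeB n r s : grade n r -> grade n s -> grade n (r - s).
Proof.
case=> p hp -> [q hq ->]; exists (p - q); last by rewrite wrc_piB.
exact: rpredB.
Qed.

Lemma gradeM m n r s : grade m r -> grade n s -> grade (m + n) (r * s).
Proof.
case=> p hp -> [q hq ->]; exists (p * q); last by rewrite wrc_piM.
exact: dhomogM.
Qed.

Lemma grade1 : grade 0 1.
Proof. by exists 1; [apply: dhomog1 | rewrite wrc_pi1]. Qed.

Lemma grade_res n r : grade n.+1 r -> wrc_res r = 0.
Proof.
case=> p hp ->; rewrite wrc_resE //.
by apply: (dhomog_nemf_coeff hp); rewrite mf0.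
Qed.

Lemma grade_lift (c : k) : exists2 r : R, grade 0 r & wrc_res r = c.
Proof.
exists (wrc_pi c%:MP); last by rewrite wrc_resE // mcoeffC eqxx mulr1.
exists c%:MP => //; rewrite -[c%:MP]mulr1 mul_mpolyC.
by apply: rpredZ; apply: dhomog1.
Qed.

(** All letters have positive weight, so R_0 consists of constants. *)
Lemma grade0_res_inj r : grade 0 r -> wrc_res r = 0 -> r = 0.
Proof.
case=> p hp ->; rewrite wrc_resE // => p0.
suff -> : p = 0 by rewrite /wrc_pi rmorph0.
apply/mpolyP => m; rewrite mcoeff0; have [->//|m0] := eqVneq m 0%MM.
apply: (dhomog_nemf_coeff hp); apply: contra_neq m0 => /eqP;
rewrite [X in X == _]wrc_weightE sum_nat_eq0 => /forallP wm; apply/mnmP => i.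
have := wm i; rewrite muln_eq0 mnm0E eqn0Ngt wt_gt0 //=.
by move/eqP.
Qed.

End CoordinateRing.

(** * The resolution *)

Lemma ltn_addl_mul a b c x y : (a <= c)%N -> (x < y)%N ->
  (a + c.+1 * x < b + c.+1 * y)%N.
Proof. by nia. Qed.

Lemma subnD_addK a b n : (a + b <= n)%N -> (n - (a + b) + a = n - b)%N.
Proof. lia. Qed.

Lemma leq_addRL a b n : (a + b <= n)%N -> (a <= n - b)%N.
Proof. lia. Qed.

Section Resolution.

Variables (k : fieldType) (D e : nat).
Hypothesis e_gt0 : (0 < e)%N.

Local Notation d := D.+1.
Local Notation R := (wrc_ring k d e).
Local Notation grade := (@wrc_homog k d e).
Local Notation shom := (shift_homog grade).
Local Notation chains := (chains D e).
Local Notation nexts := (nexts D e).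
Local Notation weight := (weight D e).
Local Notation wdeg := (wdeg D e).
Local Notation key := (key D e).
Local Notation dehom := (@dehom k D e).
Local Notation wt := (wt D e).
Local Notation tdeg := (tdeg D e).

(** The inverse of [dehom] on R_n, meaningful only for polynomials whose exponents satisfy
    [lam n]. *)
Definition rehom n (q : {poly k}) : R :=
  epsilon (inhabits 0) (fun r => grade n r /\ dehom r = q).

Lemma rehomP n (q : {poly k}) : (forall b, q`_b != 0 -> lam D e n b) ->
  grade n (rehom n q) /\ dehom (rehom n q) = q.
Proof.
move=> hq; have [r gr rq] := dehom_surj e_gt0 hq.
by apply: (epsilon_spec _ (fun r => grade n r /\ dehom r = q)); exists r.
Qed.

Lemma rehomXP n b : lam D e n b ->
  grade n (rehom n 'X^b) /\ dehom (rehom n 'X^b) = 'X^b.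
Proof.
move=> nb; apply: rehomP => c; rewrite coefXn.
by have [->|_] := eqVneq c b; rewrite ?eqxx.
Qed.

Lemma shom0 j n : shom j n 0.
Proof. by apply: shift_homog0; apply: grade0. Qed.

Lemma shomB j n r s : shom j n r -> shom j n s -> shom j n (r - s).
Proof. by apply: shift_homogB; apply: gradeB. Qed.

Lemma shomD j n r s : shom j n r -> shom j n s -> shom j n (r + s).
Proof. by apply: shift_homogD; [apply: grade0 | apply: gradeB]. Qed.

Lemma shomM m l j r s : shom l j r -> shom m l s -> shom m j (r * s).
Proof. by apply: shift_homogM; [apply: grade0 | apply: gradeM]. Qed.

Lemma shom_sum j n I (s : seq I) (P : pred I) (F : I -> R) :
  (forall i, P i -> shom j n (F i)) -> shom j n (\sum_(i <- s | P i) F i).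
Proof. by apply: shift_homog_sum; [apply: grade0 | apply: gradeB]. Qed.

(** The monomial makes the differential homogeneous. The truncated subtractions are harmless: on
    words of letters a nonzero incidence forces [w] to have smaller weight and no larger degree. *)
Definition entry (v w : seq nat) : R :=
  incidence D e R v w * rehom (weight v - weight w) 'X^(wdeg v - wdeg w).

Lemma incidence_morph (A B : pzRingType) (f : {rmorphism A -> B}) v w :
  f (incidence D e A v w) = incidence D e B v w.
Proof.
rewrite /incidence rmorph_sum; apply: eq_bigr => i _.
by rewrite rmorphM rmorphXn rmorphN1 rmorph_nat.
Qed.

Lemma grade_incidence v w : grade 0 (incidence D e R v w).
Proof.
have := @shom_sum 0 0 _ (index_enum _) xpredT
  (fun k : 'I_(size v) => (-1) ^+ k * (face D e k v == w)%:R : R).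
rewrite /shift_homog /= subnn; apply=> i _.
have g1 := @grade1 k D e; have g0 := @grade0 k D e 0.
have gN1 : grade 0 (-1) by rewrite -[-1]add0r; apply: gradeB.
rewrite -[0%N]add0n -signr_odd; apply: gradeM; first by case: odd.
by case: eqP.
Qed.

Lemma incidence_le (A : pzRingType) v w : all (fun l => l <= D + e)%N v ->
    incidence D e A v w != 0 ->
  [/\ (weight w < weight v)%N, (wdeg w <= wdeg v)%N
    & lam D e (weight v - weight w) (wdeg v - wdeg w)].
Proof. by move=> hv /incidence_neq0[j jv <-]; apply: weight_face. Qed.

Lemma homog_entry v w : all (fun l => l <= D + e)%N v ->
  shom (weight w) (weight v) (entry v w).
Proof.
move=> hv; rewrite /entry; have [->|nz] := eqVneq (incidence D e R v w) 0.
  by rewrite mul0r; apply: shom0.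
have [lt_w _ /rehomXP[g _]] := incidence_le hv nz.
rewrite /shift_homog (ltnW lt_w) -[(_ - _)%N]add0n.
by apply: gradeM; first exact: grade_incidence.
Qed.

Lemma res_entry v w : all (fun l => l <= D + e)%N v -> wrc_res (entry v w) = 0.
Proof.
move=> hv; rewrite /entry; have [->|nz] := eqVneq (incidence D e R v w) 0.
  by rewrite mul0r rmorph0.
have [lt_w _ /rehomXP[g _]] := incidence_le hv nz.
have lt0 : (0 < weight v - weight w)%N by rewrite subn_gt0.
apply: (@grade_res k D e (weight v - weight w).-1); rewrite prednK //.
rewrite -[(_ - _)%N]add0n; apply: gradeM => //; exact: grade_incidence.
Qed.

Lemma dehom_entry v w : all (fun l => l <= D + e)%N v ->
  dehom (entry v w) = incidence D e {poly k} v w * 'X^(wdeg v - wdeg w).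
Proof.
move=> hv; rewrite /entry rmorphM incidence_morph /=.
have [->|nz] := eqVneq (incidence D e {poly k} v w) 0; first by rewrite !mul0r.
by have [_ _ /rehomXP[_ ->]] := incidence_le hv nz.
Qed.

Lemma chains_letters i v : v \in chains i -> all (fun l => l <= D + e)%N v.
Proof. by rewrite mem_chains => /andP[_ /is_chain_letters]. Qed.

(** Checked at s = 1, where every nonzero term carries the same monomial, so that only the incidence
    numbers remain. *)
Lemma entry_entry i v x : v \in chains i.+2 -> x \in chains i ->
  \sum_(w <- chains i.+1) entry v w * entry w x = 0.
Proof.
move=> vi xi; have hv := chains_letters vi.
have : shom (weight x) (weight v) (\sum_(w <- chains i.+1) entry v w * entry w x).
  rewrite big_seq; apply: shom_sum => w /chains_letters hw.
  by apply: shomM; apply: homog_entry.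
rewrite /shift_homog; case: leqP => // _ /dehom_inj; apply=> //.
rewrite rmorph_sum /= big_seq.
under eq_bigr => w wi.
  rewrite rmorphM /= (dehom_entry _ hv) (dehom_entry _ (chains_letters wi)) mulrACA -exprD.
  rewrite (_ : _ * 'X^_ = incidence D e {poly k} v w * incidence D e {poly k} w x *
     'X^(wdeg v - wdeg x)); last first.
    have [->|nz] := eqVneq (incidence D e {poly k} v w) 0; first by rewrite !mul0r.
    have [->|nz'] := eqVneq (incidence D e {poly k} w x) 0.
      by rewrite mulr0 !mul0r.
    have [_ h1 _] := incidence_le hv nz.
    have [_ h2 _] := incidence_le (chains_letters wi) nz'.
    by rewrite addnBA // subnK.
  over.
by rewrite -big_seq -mulr_suml incidence_incidence ?mul0r.
Qed.

Lemma entry_behead q w : is_chain D e (q :: w) ->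
  entry (q :: w) w = rehom (wt q) 'X^(tdeg q).
Proof.
by move=> cv; rewrite /entry incidence_behead // mul1r /weight /wdeg /= !addnK.
Qed.

Lemma entry_key q w x : is_chain D e (q :: w) -> entry (q :: w) x != 0 ->
  x = w \/ (key x < key w)%N.
Proof.
move=> cv nz; apply: (incidence_key e_gt0 (A := R) cv).
by apply: contraNneq nz => i0; rewrite /entry i0 mul0r.
Qed.

Lemma is_chain_next i q w : w \in chains i -> q \in nexts w ->
  is_chain D e (q :: w).
Proof. by rewrite mem_chains is_chain_cons => /andP[_ ->]. Qed.

(** Each monomial of [r] is assigned to the first letter of [L] dividing it, and the quotients are
    collected letter by letter. *)
Lemma divides_sum (L : seq nat) m r : uniq L -> {in L, forall l, l <= D + e}%N ->
    grade m r ->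
    (forall b, (dehom r)`_b != 0 -> exists2 l, l \in L & divides_by D e l m b) ->
  exists2 f : nat -> R, forall l, l \in L -> shom (wt l) m (f l) &
    r = \sum_(l <- L) f l * rehom (wt l) 'X^(tdeg l).
Proof.
move=> uL hL gr hr; set q := dehom r in hr.
pose sel b := nth 0%N L (find (fun l => divides_by D e l m b) L).
have selP b : q`_b != 0 -> sel b \in L /\ divides_by D e (sel b) m b.
  move=> /hr[l lL hl].
  have hasL : has (fun l => divides_by D e l m b) L by apply/hasP; exists l.
  split; first by rewrite mem_nth // -has_find.
  exact: (nth_find 0%N hasL).
pose Q l := \sum_(b < size q | sel b == l) q`_b *: 'X^(b - tdeg l).
have QP l c : (Q l)`_c != 0 -> (wt l <= m)%N /\ lam D e (m - wt l) c.
  rewrite coef_sum => nz.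
  have [b /andP[/eqP sb qb]] : exists b : 'I_(size q), (sel b == l) &&
      ((q`_b *: 'X^(b - tdeg l))`_c != 0).
    apply/existsP; apply: contraR nz => /existsPn nz; rewrite big1 // => b sb.
    by have := nz b; rewrite sb negbK => /eqP.
  move: qb; rewrite coefZ coefXn; have [->|_] := eqVneq c; last by rewrite mulr0 eqxx.
  by rewrite mulr1 => /selP[_]; rewrite sb => /and3P[].
(* If [wt l] exceeds [m], no monomial is assigned to [l] and [Q l] is 0, in agreement with the
   default value. *)
pose f l : R := if (wt l <= m)%N then rehom (m - wt l) (Q l) else 0.
have fg l : shom (wt l) m (f l).
  rewrite /f /shift_homog; case: leqP => // wl.
  by have [] := rehomP (fun c hc => (QP l c hc).2).
exists f => [l _|]; first exact: fg.
have fP l : dehom (f l) = Q l.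
  rewrite /f; case: leqP => wl.
    by have [] := rehomP (fun c hc => (QP l c hc).2).
  rewrite rmorph0; apply/esym/polyP => c; rewrite coef0.
  by apply/eqP/negPn/negP => /QP[]; rewrite leqNgt wl.
have letterP l : l \in L -> grade (wt l) (rehom (wt l) 'X^(tdeg l)) /\
    dehom (rehom (wt l) 'X^(tdeg l)) = 'X^(tdeg l).
  by move=> lL; apply: rehomXP; apply: lam_letter => //; apply: hL.
apply/eqP; rewrite -subr_eq0; apply/eqP; apply: (@dehom_inj k D e e_gt0 m).
  apply: gradeB => //; have := @shom_sum 0 m _ L (fun l => l \in L)
    (fun l => f l * rehom (wt l) 'X^(tdeg l)).
  rewrite -big_seq /shift_homog /= subn0; apply=> l lL.
  have := fg l; rewrite /shift_homog; case: leqP => [wl g|_ ->].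
    by rewrite -(subnK wl); apply: gradeM => //; case: (letterP l lL).
  by rewrite mul0r; apply: grade0.
rewrite rmorphB rmorph_sum /= -/q big_seq.
under eq_bigr => l lL do
  rewrite rmorphM /= fP (letterP l lL).2 mulr_suml.
rewrite -big_seq; under eq_bigr => l _ do rewrite big_mkcond.
rewrite exchange_big /= -[X in X - _]coefK poly_def -sumrB big1 // => b _.
have [->|qb] := eqVneq q`_b 0.
  by rewrite scale0r big1 ?subr0 // => l _; case: ifP; rewrite ?scale0r ?mul0r.
have [sL /and3P[_ tb _]] := selP b qb.
rewrite (bigD1_seq (sel b)) //= eqxx -scalerAl -exprD subnK //.
by rewrite big1 ?addr0 ?subrr // => l /negPf; rewrite eq_sym => ->.
Qed.

(** * Cycles are boundaries *)

(** An element of the i-th module is a coefficient function [u] on words, of which only the values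
    on [chains i] matter. *)
Definition bdry i (u : seq nat -> R) x := \sum_(v <- chains i) u v * entry v x.

Definition chain_cycle i (u : seq nat -> R) : Prop :=
  match i with
  | 0 => wrc_res (u [::]) = 0
  | i'.+1 => {in chains i', forall x, bdry i u x = 0}
  end.

Definition of_degree i n (u : seq nat -> R) :=
  {in chains i, forall v, shom (weight v) n (u v)}.

Lemma cycle_bdry i u : chain_cycle i (bdry i.+1 u).
Proof.
case: i => [|i] /=.
  rewrite /bdry rmorph_sum /= big_seq big1 // => v vi.
  by rewrite rmorphM /= res_entry ?mulr0 ?(chains_letters vi).
move=> x xi; rewrite /bdry; under eq_bigr => v _ do rewrite mulr_suml.
rewrite exchange_big /= big_seq big1 // => v vi.
by under eq_bigr => w _ do rewrite -mulrA; rewrite -mulr_sumr entry_entry ?mulr0.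
Qed.

Lemma cycleB i u v : chain_cycle i u -> chain_cycle i v -> chain_cycle i (fun x => u x - v x).
Proof.
case: i => [|i] /=; first by move=> u0 v0; rewrite rmorphB /= u0 v0 subrr.
move=> cu cv x xi; rewrite /bdry; under eq_bigr => w _ do rewrite mulrBl.
by rewrite sumrB [X in X - _]cu // [X in _ - X]cv // subrr.
Qed.

Lemma of_degree_bdry i n u : of_degree i.+1 n u -> of_degree i n (bdry i.+1 u).
Proof.
move=> hu x xi; rewrite /bdry big_seq; apply: shom_sum => v vi.
by apply: shomM (hu v vi) _; apply: homog_entry (chains_letters vi).
Qed.

Lemma weight_cons q w : weight (q :: w) = (wt q + weight w)%N.
Proof. by []. Qed.

(* If [l] were the least letter dividing the product of [l] and a monomial of the
   leading coefficient, then that product could not cancel at [y] in the boundary,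
   where [v = l :: y]. *)
Lemma leading_divides i n u K v b : of_degree i n u -> chain_cycle i u ->
    {in chains i, forall v, (K < key v)%N -> u v = 0} ->
    v \in chains i -> key v = K -> (weight v <= n)%N -> (dehom (u v))`_b != 0 ->
  exists2 l, l \in nexts v & divides_by D e l (n - weight v) b.
Proof.
move=> hu cu lead vi vK vn nz.
have uv : u v != 0 by apply: contraNneq nz => ->; rewrite rmorph0 coef0.
have := hu v vi; rewrite /shift_homog vn => gv.
have lamv := dehom_grade e_gt0 gv nz.
case: i hu cu lead vi => [|i] hu cu lead vi.
  (* For [i = 0] a nonzero cycle has positive degree, since it lies in the maximal ideal, and any
     letter may start a word. *)
  have v0 : v = [::] by move: vi; rewrite inE => /eqP.
  have n_gt0 : (0 < n)%N.
    rewrite lt0n; apply: contraNneq uv => n0.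
    apply/eqP; apply: (grade0_res_inj e_gt0); last by rewrite v0.
    by move: gv; rewrite n0.
  rewrite v0 subn0 in lamv *.
  have [l lD dl] := divides_letter e_gt0 n_gt0 lamv.
  by exists l; rewrite // mem_nexts lD.
have [l [y [yi ly vE]]] : exists l y, [/\ y \in chains i, l \in nexts y & v = l :: y].
  by move: vi => /allpairsPdep[y [l [yi ly ->]]]; exists l, y.
subst v; have cv := is_chain_next yi ly.
have lD : (l <= D + e)%N by move: ly; rewrite mem_nexts => /andP[].
have chn l' z : z \in chains i -> l' \in nexts z -> l' :: z \in chains i.+1.
  by move=> zi l'z; apply/allpairsPdep; exists z, l'.
(* This is the boundary at [y]. A word [l' :: z] with [z] other than [y] and a nonzero entry at [y]
   satisfies [key y < key z], so its key exceeds [K] and [u] vanishes on it. *)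
have sum0 : \sum_(l' <- nexts y) u (l' :: y) * rehom (wt l') 'X^(tdeg l') = 0.
  rewrite -[RHS](cu y yi) /bdry sum_chainsS (bigD1_seq y) ?uniq_chains //=.
  rewrite [X in _ = _ + X]big_seq_cond [X in _ = _ + X]big1 ?addr0.
    rewrite big_seq [RHS]big_seq; apply: eq_bigr => l' l'y.
    by rewrite entry_behead // (is_chain_next yi).
  move=> z /andP[zi zy]; rewrite big_seq big1 // => l' l'z.
  have [->|nz'] := eqVneq (entry (l' :: z) y) 0; first by rewrite mulr0.
  have [yz|lt_yz] := entry_key (is_chain_next zi l'z) nz'.
    by rewrite yz eqxx in zy.
  rewrite lead ?mul0r ?chn // -vK /=.
  by apply: ltn_addl_mul; first exact: lrank_le.
(* The term of [l] has a nonzero coefficient at [b + tdeg l], which another letter must cancel. *)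
have [l' [l'y l'l nz']] : exists l', [/\ l' \in nexts y, l' != l &
    (dehom (u (l' :: y)) * 'X^(tdeg l'))`_(b + tdeg l) != 0].
  have [/hasP[l' l'y /andP[l'l nz']]|/hasPn none] := boolP (has (fun l' => (l' != l) &&
      ((dehom (u (l' :: y)) * 'X^(tdeg l'))`_(b + tdeg l) != 0)) (nexts y)).
    by exists l'.
  case/eqP: nz; have := congr1 (fun r => (dehom r)`_(b + tdeg l)) sum0.
  rewrite rmorph0 coef0 rmorph_sum /= coef_sum (bigD1_seq l) //=; last first.
    by rewrite filter_uniq // iota_uniq.
  have letP l' : l' \in nexts y -> dehom (rehom (wt l') 'X^(tdeg l')) = 'X^(tdeg l').
    rewrite mem_nexts => /andP[l'D _].
    by have [] := rehomXP (lam_letter l'D).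
  rewrite rmorphM /= letP // coefMXn ltnNge leq_addl /= addnK.
  rewrite big_seq_cond big1 ?addr0 // => l' /andP[l'y l'l].
  by have := none l' l'y; rewrite l'l negbK rmorphM /= letP // => /eqP.
have l'yi := chn _ _ yi l'y.
move: nz'; rewrite coefMXn; case: ltnP => [_|tl']; first by rewrite eqxx.
move=> nz'; have ul' : u (l' :: y) != 0.
  by apply: contraNneq nz' => ->; rewrite rmorph0 coef0.
have := hu _ l'yi; rewrite /shift_homog; case: leqP => [wl'|_ /eqP]; last first.
  by rewrite (negPf ul').
move=> /(dehom_grade e_gt0)/(_ nz'){nz'} lam'.
(* Otherwise [l' :: y] would have a key above [K], where [u] vanishes. *)
have rl' : (lrank D l' < lrank D l)%N.
  have rneq : lrank D l' != lrank D l by apply: contra_neq l'l; apply: lrank_inj.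
  rewrite ltn_neqAle rneq.
  rewrite leqNgt; apply: contraNN ul' => rl'; rewrite lead // -vK /=.
  by rewrite ltn_add2r.
rewrite !weight_cons in vn wl' lam' *.
have dl' : divides_by D e l' (n - (wt l + weight y) + wt l) (b + tdeg l).
  by rewrite subnD_addK // /divides_by tl' subnAC -subnDA lam' leq_addRL.
have [l'' l''D /andP[fl'' dl'']] := divides_forb e_gt0 lD lamv rl' dl'.
by exists l''; rewrite // mem_nexts l''D.
Qed.

(** The leading coefficient is a combination of the letters that extend [v], hence the leading term
    of a boundary. *)
Lemma leading_step i n u K v : of_degree i n u -> chain_cycle i u ->
    {in chains i, forall v, (K < key v)%N -> u v = 0} ->
    v \in chains i -> key v = K ->
  exists f : nat -> R, (forall l, l \in nexts v -> shom (weight (l :: v)) n (f l)) /\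
    u v = \sum_(l <- nexts v) f l * rehom (wt l) 'X^(tdeg l).
Proof.
move=> hu cu lead vi vK; have [vn|nv] := leqP (weight v) n; last first.
  exists (fun=> 0); split=> [l _|]; first exact: shom0.
  have := hu v vi; rewrite /shift_homog leqNgt nv /= => ->.
  by rewrite big1 // => l _; rewrite mul0r.
have := hu v vi; rewrite /shift_homog vn => gv.
have hdiv b := leading_divides (b := b) hu cu lead vi vK vn.
have uL : uniq (nexts v) by rewrite filter_uniq // iota_uniq.
have hL : {in nexts v, forall l, l <= D + e}%N.
  by move=> l; rewrite mem_nexts => /andP[].
have [f hf uE] := divides_sum uL hL gv hdiv.
exists f; split=> // l /hf; rewrite /shift_homog weight_cons.
have -> : (wt l + weight v <= n)%N = (wt l <= n - weight v)%N.
  by rewrite leq_subRL ?vn // addnC.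
by rewrite subnDA subnAC.
Qed.

(** Induction on a strict bound [K] for the keys of the words in the support: subtracting a boundary
    removes the terms of highest key. *)
Lemma cycle_boundary i n u : of_degree i n u -> chain_cycle i u ->
  exists2 w, of_degree i.+1 n w & {in chains i, forall v, u v = bdry i.+1 w v}.
Proof.
move=> hu cu; have [K leK] : exists K, {in chains i, forall v, (key v < K)%N}.
  exists (\max_(v <- chains i) key v).+1 => v vi.
  by rewrite ltnS leq_bigmax_seq.
have {leK} : {in chains i, forall v, (K <= key v)%N -> u v = 0}.
  by move=> v /leK; rewrite ltnNge => /negPf ->.
elim: K u hu cu => [|K IHK] u hu cu lead.
  exists (fun=> 0) => v vi; first exact: shom0.
  by rewrite lead // /bdry big1 // => w _; rewrite mul0r.
pose P v (f : nat -> R) :=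
  (forall l, l \in nexts v -> shom (weight (l :: v)) n (f l)) /\
  u v = \sum_(l <- nexts v) f l * rehom (wt l) 'X^(tdeg l).
pose F v := epsilon (inhabits (fun=> 0)) (P v).
have FP v : v \in chains i -> key v = K -> P v (F v).
  move=> vi vK; apply: (epsilon_spec _ (P v)).
  exact: leading_step hu cu lead vi vK.
pose w0 (x : seq nat) : R :=
  if x is l :: v then if key v == K then F v l else 0 else 0.
have hw0 : of_degree i.+1 n w0.
  move=> x /allpairsPdep[v [l [vi ly ->]]] /=.
  by case: eqP => [vK|_]; [case: (FP v vi vK) => + _; apply | apply: shom0].
pose u' v := u v - bdry i.+1 w0 v.
have hu' : of_degree i n u'.
  by move=> v vi; apply: shomB; [apply: hu | apply: of_degree_bdry].
have cu' : chain_cycle i u' by apply: cycleB => //; apply: cycle_bdry.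
have lead' : {in chains i, forall v, (K <= key v)%N -> u' v = 0}.
  (* At keys [K] and above, the boundary of [w0] consists only of the leading terms of its words. *)
  move=> v vi vK; rewrite /u' /bdry sum_chainsS (bigD1_seq v) ?uniq_chains //=.
  rewrite [X in _ - (_ + X)]big_seq_cond [X in _ - (_ + X)]big1 ?addr0; last first.
    move=> z /andP[zi zv]; rewrite big_seq big1 // => l lz.
    case: eqP => [zK|_]; last by rewrite mul0r.
    have [->|nz] := eqVneq (entry (l :: z) v) 0; first by rewrite mulr0.
    have [vz|] := entry_key (is_chain_next zi lz) nz; first by rewrite vz eqxx in zv.
    by rewrite zK ltnNge vK.
  case: eqP => [vK'|/eqP vK']; last first.
    rewrite lead //; last by rewrite ltn_neqAle eq_sym vK'.
    by rewrite big1 ?subrr // => l _; rewrite mul0r.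
  have [_ ->] := FP v vi vK'; apply/eqP; rewrite subr_eq0; apply/eqP.
  rewrite big_seq [RHS]big_seq; apply: eq_bigr => l lv.
  by rewrite entry_behead // (is_chain_next vi).
have [w hw wE] := IHK u' hu' cu' lead'.
exists (fun x => w0 x + w x) => x xi; first exact: shomD (hw0 x xi) (hw x xi).
rewrite /bdry; under eq_bigr => v _ do rewrite mulrDl.
rewrite big_split /= -[X in _ + X]wE // /u'.
by rewrite addrC subrK.
Qed.

(** * The complex in matrix form *)

Definition gens i j := [seq w <- chains i | weight w == j].

Definition chain_complex : gfree_complex k R :=
  @GFreeComplex k R (fun i j => size (gens i j))
    (fun i j l => \matrix_(a, b)
       entry (nth [::] (gens i.+1 j) a) (nth [::] (gens i l) b))
    (const_mx 1).

Local Notation G := chain_complex.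

Lemma mem_gens i j (a : 'I_(size (gens i j))) : 
  nth [::] (gens i j) a \in chains i /\ weight (nth [::] (gens i j) a) = j.
Proof.
by have := mem_nth [::] (ltn_ord a); rewrite mem_filter => /andP[/eqP ? ?].
Qed.

(** The weight of a word determines the block holding its coordinate, so coordinate vectors come
    from functions on words. *)
Lemma gfc_eltP i (v : gfc_elt G i) :
  exists u : seq nat -> R, v = fun j => \row_a u (nth [::] (gens i j) a).
Proof.
pose f j (w : seq nat) : R := \sum_(a < size (gens i j))
  (if nth [::] (gens i j) a == w then v j 0 a else 0).
exists (fun w => f (weight w) w).
apply: functional_extensionality_dep => j; apply/rowP => a; rewrite mxE.
have [_ ->] := mem_gens a; rewrite /f (bigD1 a) //= eqxx big1 ?addr0 // => b ba.
by rewrite nth_uniq ?filter_uniq ?uniq_chains // (inj_eq val_inj) (negPf ba).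
Qed.

Lemma in_degreeE i n (u : seq nat -> R) :
  in_degree grade n ((fun j => \row_a u (nth [::] (gens i j) a)) : gfc_elt G i)
    <-> of_degree i n u.
Proof.
split=> [hu v vi|hu j a]; last first.
  by rewrite mxE; have [/hu + wa] := mem_gens a; rewrite wa.
have vg : v \in gens i (weight v) by rewrite mem_filter eqxx.
have lt_v : (index v (gens i (weight v)) < size (gens i (weight v)))%N.
  by rewrite index_mem.
have := hu (weight v) (Ordinal lt_v); rewrite mxE /= nth_index //.
Qed.

Lemma apply_diffE i n (u : seq nat -> R) l b : of_degree i.+1 n u ->
  apply_diff n ((fun j => \row_a u (nth [::] (gens i.+1 j) a)) : gfc_elt G i.+1)
    l 0 b = bdry i.+1 u (nth [::] (gens i l) b).
Proof.
move=> hu; rewrite /apply_diff summxE /bdry; set x := nth _ _ b.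
transitivity (\sum_(j < n.+1) \sum_(v <- gens i.+1 j) u v * entry v x).
  apply: eq_bigr => j _; rewrite mxE (big_nth [::]) big_mkord.
  by apply: eq_bigr => a _; rewrite !mxE.
under eq_bigr => j _ do rewrite big_filter big_mkcond.
rewrite exchange_big /= big_seq [RHS]big_seq; apply: eq_bigr => v vi.
(* The sum over [j] picks the block of weight [weight v]; words heavier than [n] have coefficient
   0. *)
rewrite -big_mkcond /=; have [vn|nv] := leqP (weight v) n.
  by rewrite (big_pred1 (Ordinal (vn : weight v < n.+1)%N)) // => j; rewrite eq_sym.
have := hu v vi; rewrite /shift_homog leqNgt nv /= => ->.
by rewrite big1 ?mul0r // => j _; rewrite mul0r.
Qed.

Lemma boundaryP i n (u : seq nat -> R) : of_degree i n u ->
  chain_cycle i u <-> exists2 w : gfc_elt G i.+1, in_degree grade n w &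
    forall l, \row_a u (nth [::] (gens i l) a) = apply_diff n w l.
Proof.
move=> hu; split=> [cu|[w hw uE]].
  have [w hw uE] := cycle_boundary hu cu.
  exists (fun j => \row_a w (nth [::] (gens i.+1 j) a)); first exact/in_degreeE.
  move=> l; apply/rowP => b; rewrite apply_diffE // mxE uE //.
  by have [] := mem_gens b.
have [w' wE] := gfc_eltP w; subst w; move: hw => /in_degreeE hw.
have {}uE : {in chains i, forall v, u v = bdry i.+1 w' v}.
  move=> v vi; have vg : v \in gens i (weight v) by rewrite mem_filter eqxx.
  have lt_v : (index v (gens i (weight v)) < size (gens i (weight v)))%N.
    by rewrite index_mem.
  have /rowP/(_ (Ordinal lt_v)) := uE (weight v).
  by rewrite apply_diffE // mxE /= nth_index.
have := cycle_bdry i w'; case: (i) uE => [|i'] uE /=.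
  by rewrite uE ?inE.
move=> cb x xi; rewrite -[RHS](cb x xi) /bdry big_seq [RHS]big_seq.
by apply: eq_bigr => v vi; rewrite uE.
Qed.

Lemma chain_complex_minimal :
  minimal_graded_free_resolution grade (@wrc_res k d e) G.
Proof.
split; last first.
  move=> i j l a b /=; rewrite mxE res_entry //.
  by have [/chains_letters] := mem_gens a.
split.
- move=> i j l a b /=; rewrite mxE.
  have [/chains_letters va wa] := mem_gens a; have [_ wb] := mem_gens b.
  by have := homog_entry (nth [::] (gens i l) b) va; rewrite wa wb.
- apply/eqP => /matrixP /(_ (Ordinal (isT : 0 < size (gens 0 0))%N) 0).
  by rewrite !mxE => /eqP; rewrite oner_eq0.
- move=> n v hv; have [u vE] := gfc_eltP v; subst v.
  rewrite -boundaryP; last exact/in_degreeE.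
  have augE : apply_aug (@wrc_res k d e)
     ((fun j => \row_a u (nth [::] (gens 0 j) a)) : gfc_elt G 0) = (wrc_res (u [::]))%:M.
    apply/matrixP => a b; rewrite (ord1 a) (ord1 b) !mxE.
    rewrite (bigD1 (Ordinal (isT : 0 < size (gens 0 0))%N)) //= !mxE mulr1.
    by rewrite big1 ?addr0 // => -[[|c] hc].
  rewrite augE; split=> [/matrixP/(_ 0 0)|/= ->]; last by rewrite raddf0.
  by rewrite !mxE.
move=> i n v hv; have [u vE] := gfc_eltP v; subst v.
have hu : of_degree i.+1 n u by apply/in_degreeE.
rewrite -boundaryP //; split=> [du x xi|cu l].
  have xg : x \in gens i (weight x) by rewrite mem_filter eqxx.
  have lt_x : (index x (gens i (weight x)) < size (gens i (weight x)))%N.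
    by rewrite index_mem.
  have /rowP/(_ (Ordinal lt_x)) := du (weight x).
  by rewrite apply_diffE // mxE /= nth_index.
apply/rowP => b; rewrite apply_diffE // mxE cu //.
by have [] := mem_gens b.
Qed.

Lemma wrc_bettiE i j : wrc_betti k d e i j = count (fun w => weight w == j) (chains i).
Proof.
rewrite /wrc_betti -size_filter.
exact: (graded_betti_rank (@grade0 k D e) (@gradeB k D e) (@gradeM k D e)
  (@grade1 k D e) (@grade_lift k D e) i j chain_complex_minimal).
Qed.

End Resolution.

(** * Counting words *)

Section Counting.

Variables D e : nat.
Local Open Scope nat_scope.
Local Notation chains := (chains D e).
Local Notation nexts := (nexts D e).

Lemma count_interval a b n (P : pred nat) : a <= b -> b <= n ->
  (forall q, q < n -> P q = (a <= q < b)) -> count P (iota 0 n) = b - a.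
Proof.
move=> ab bn PE; rewrite (eq_in_count (a2 := [pred q | a <= q < b])); last first.
  by move=> q; rewrite mem_iota add0n => /PE.
have -> : iota 0 n = iota 0 a ++ iota a (b - a) ++ iota b (n - b).
  rewrite (_ : n = a + ((b - a) + (n - b))) ?iotaD; last by lia.
  by rewrite add0n subnKC // (_ : a + (b - a + (n - b)) - b = n - b) //; lia.
rewrite !count_cat addnA.
rewrite [X in _ + X](_ : _ = 0) ?addn0; last first.
  by apply/eqP; rewrite -leqn0 leqNgt -has_count; apply/hasPn => q;
     rewrite mem_iota /= => /andP[bq _]; rewrite ltnNge bq andbF.
rewrite [X in X + _](_ : _ = 0) ?add0n; last first.
  by apply/eqP; rewrite -leqn0 leqNgt -has_count; apply/hasPn => q;
     rewrite mem_iota /= => qa; rewrite leqNgt qa.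
rewrite -[RHS](size_iota a); apply/eqP; rewrite -all_count; apply/allP => q.
by rewrite mem_iota subnKC.
Qed.

Lemma weight_eq_size w : 1 < e ->
  (weight D e w == size w) = all (fun l => l <= D) w.
Proof.
(* The inequality is added to make the induction work: a letter beyond [D] makes it strict. *)
move=> e1; have : size w <= weight D e w /\
    (weight D e w == size w) = all (fun l => l <= D) w; last by case.
elim: w => //= l w [le_w eq_w]; rewrite weight_cons /wt -eq_w.
by case: ifP => _; split; lia.
Qed.

Lemma weight_eq_max w : 1 < e ->
  (weight D e w == e * size w) = all (fun l => D < l) w.
Proof.
move=> e1; have : weight D e w <= e * size w /\
    (weight D e w == e * size w) = all (fun l => D < l) w; last by case.
elim: w => [|l w [le_w eq_w]] /=; first by rewrite /weight /= muln0.
rewrite weight_cons /wt -eq_w mulnS ltnNge.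
by case: ifP => _ /=; split; lia.
Qed.

Lemma count_chainsS (P : pred nat) i :
  count (all P) (chains i.+1) =
  \sum_(w <- chains i | all P w) count P (nexts w).
Proof.
rewrite -sum1_count big_mkcond sum_chainsS [RHS]big_mkcond /=.
apply: eq_bigr => w _; rewrite -sum1_count; case: (all P w); last first.
  by rewrite big1 // => q _; rewrite andbF.
by rewrite [RHS]big_mkcond; apply: eq_bigr => q _; rewrite andbT.
Qed.

Lemma count_nexts (P : pred nat) a b w : a <= b -> b <= (D + e).+1 ->
    (forall q, q <= D + e ->
      P q && (if w is p :: _ then forb D e p q else true) = (a <= q < b)) ->
  count P (nexts w) = b - a.
Proof.
by move=> ab bn PE; rewrite count_filter; apply: count_interval.
Qed.

(** There are [D] first letters, and each later letter must avoid 0. *)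
Lemma count_pos_chains i : 0 < e ->
  count (all (fun l => l < D)) (chains i.+1) = D * D.-1 ^ i.
Proof.
move=> e0; elim: i => [|i IHi]; rewrite count_chainsS.
  rewrite -[chains 0]/[:: [::]] big_cons big_nil addn0 muln1 (@count_nexts _ 0 D) ?subn0 //; first lia.
  by move=> q _; rewrite andbT.
rewrite expnSr mulnA -IHi -sum1_count big_distrl /= big_seq_cond [RHS]big_seq_cond.
apply: eq_bigr => -[|p w] /andP[]; first by rewrite mem_chains.
move=> _ /= /andP[pD _]; rewrite mul1n (@count_nexts _ 1 D) ?subn1 //; try lia.
by move=> q _; rewrite /forb pD; lia.
Qed.

(** Only the last letter can be [D], so it has the [D] values from 1 to [D]; the letters before it
    are counted by [count_pos_chains]. *)
Lemma count_linear_chains i : 0 < e ->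
  count (all (fun l => l <= D)) (chains i.+2) = D ^ 2 * D.-1 ^ i.
Proof.
move=> e0; rewrite count_chainsS expnS expn1 -mulnA -count_pos_chains //.
rewrite -sum1_count big_distrr /= big_mkcond [RHS]big_mkcond /=.
rewrite big_seq [RHS]big_seq; apply: eq_bigr => -[|p w]; first by rewrite mem_chains.
rewrite mem_chains => /andP[_ cw] /=.
have wD : all (fun l => l < D) w = all (fun l => l <= D) w.
  apply: eq_in_all => l lw; rewrite [RHS]leq_eqVlt.
  suff /negPf -> : l != D by [].
  by apply: contraNneq (is_chain_zero cw) => <-.
(* No letter up to [D] can follow [D], so words with head [D] have no extension of the required
   kind. *)
rewrite wD [(p <= D)]leq_eqVlt; case: eqP => [->|_] /=.
  rewrite ltnn /=; case: ifP => // _.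
  by rewrite (@count_nexts _ 0 0) // => q _; rewrite /forb ltnn andbF.
case: ifP => // /andP[pD _]; rewrite muln1 (@count_nexts _ 1 D.+1) ?subn1 //; try lia.
by move=> q _; rewrite /forb pD; lia.
Qed.

Lemma count_linear_letters : count (all (fun l => l <= D)) (chains 1) = D.+1.
Proof.
rewrite count_chainsS -[chains 0]/[:: [::]] big_cons big_nil addn0 (@count_nexts _ 0 D.+1) ?subn0 //; first lia.
by move=> q _; rewrite andbT.
Qed.

(** There are [e] first letters, and each later letter must avoid [D + e]. *)
Lemma count_twisted_chains i : 0 < e ->
  count (all (fun l => D < l)) (chains i.+1) = e * e.-1 ^ i.
Proof.
move=> e0; elim: i => [|i IHi]; rewrite count_chainsS.
  by rewrite -[chains 0]/[:: [::]] big_cons big_nil addn0 muln1 (@count_nexts _ D.+1 (D + e).+1) /=; lia.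
rewrite expnSr mulnA -IHi -sum1_count big_distrl /= big_seq_cond [RHS]big_seq_cond.
apply: eq_bigr => -[|p w] /andP[]; first by rewrite mem_chains.
move=> _ /= /andP[pD _]; rewrite mul1n (@count_nexts _ D.+1 (D + e)); try lia.
by move=> q _; rewrite /forb pD; lia.
Qed.

End Counting.

(** * The two extremal strands *)

(** For [e = 1] all letters have weight 1 and the two strands coincide, whence the restriction to
    [1 < e] in positive homological degree. *)
Lemma wrc_betti_linear (k : fieldType) (d e i : nat) :
    (1 <= d)%N -> (1 <= e)%N -> i = 0%N \/ (1 < e)%N ->
  (wrc_betti k d e i i)%:Z =
    match i with
    | 0 => 1
    | 1 => d%:Z
    | i'.+2 => (d%:Z - 2) ^+ i' * (d%:Z - 1) ^+ 2
    end.
Proof.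
case: d => // D _ e0 ie; rewrite wrc_bettiE //.
case: i ie => [//|i] [//|e1].
rewrite (eq_in_count (a2 := all (fun l => l <= D)%N)); last first.
  by move=> w; rewrite mem_chains => /andP[/eqP <- _]; rewrite weight_eq_size.
case: i => [|i]; first by rewrite count_linear_letters.
(* For [D = 0] the truncated [D.-1] differs from [d - 2 = -1], but both sides have a zero factor. *)
rewrite count_linear_chains // PoszM mulrC -!natz !natrX !natz; case: D => [|D].
  by rewrite subrr !expr0n !mulr0.
by congr (_ ^+ _ * _ ^+ _); lia.
Qed.

Lemma wrc_betti_twisted (k : fieldType) (d e i : nat) :
    (1 <= d)%N -> (1 <= e)%N -> i = 0%N \/ (1 < e)%N ->
  (wrc_betti k d e i (e * i))%:Z =
    match i with
    | 0 => 1
    | i'.+1 => e%:Z * (e%:Z - 1) ^+ i'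
    end.
Proof.
case: d => // D _ e0 ie; rewrite wrc_bettiE //.
case: i ie => [|i] [//|e1]; rewrite ?muln0 //.
rewrite (eq_in_count (a2 := all (fun l => D < l)%N)); last first.
  by move=> w; rewrite mem_chains => /andP[/eqP <- _]; rewrite weight_eq_max.
by rewrite count_twisted_chains // PoszM -[X in _ * X]natz natrX natz predn_int.
Qed.

Theorem corollary5p12 (k : fieldType) (d e : nat)
    (d_ge1 : (1 <= d)%N) (e_ge1 : (1 <= e)%N) :
  [/\ forall i : nat, i = 0%N \/ (1 < e)%N ->
        (wrc_betti k d e i i)%:Z =
          match i with
          | 0 => 1
          | 1 => d%:Z
          | i'.+2 => (d%:Z - 2) ^+ i' * (d%:Z - 1) ^+ 2
          end,
      forall i : nat, i = 0%N \/ (1 < e)%N ->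
        (wrc_betti k d e i (e * i))%:Z =
          match i with
          | 0 => 1
          | i'.+1 => e%:Z * (e%:Z - 1) ^+ i'
          end,
      (2 < d)%N -> infinite_strand (fun i => wrc_betti k d e i i),
      (1 < e)%N -> infinite_strand (fun i => wrc_betti k d e i (e * i))
    & (1 < e)%N ->
        (forall (k' : fieldType) (e' : nat), (1 < e')%N ->
           forall i, wrc_betti k' d e' i i = wrc_betti k d e i i) /\
        (forall (k' : fieldType) (d' : nat), (1 <= d')%N ->
           forall i, wrc_betti k' d' e i (e * i) = wrc_betti k d e i (e * i))].
Proof.
have lin := wrc_betti_linear k d_ge1 e_ge1.
have twi := wrc_betti_twisted k d_ge1 e_ge1.
split=> // [d_gt2|e_gt1|e_gt1].
- move=> n; exists n.+2; first by rewrite leqW.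
  case: d d_ge1 d_gt2 {lin twi} => // D _ D_gt1; rewrite wrc_bettiE // -lt0n.
  (* Words with all letters up to [D] bound the Betti number from below, also for [e = 1]. *)
  apply: leq_trans (_ : count (all (fun l => l <= D)%N) (chains D e n.+2) <= _)%N.
    by rewrite count_linear_chains // muln_gt0 expn_gt0 expn_gt0; lia.
  rewrite (eq_in_count (a2 := fun w => (weight D e w == n.+2) &&
      all (fun l => l <= D)%N w)); first by apply: sub_count => w /andP[].
  move=> w; rewrite mem_chains => /andP[/eqP <- _].
  case lin_w : (all _ w); rewrite ?andbF ?andbT //; apply/esym/eqP.
  elim: w lin_w => //= l w IHw /andP[lD /IHw <-].
  by rewrite weight_cons /wt lD.
- move=> n; exists n.+1; first exact: leqnSn.
  rewrite -eqz_nat twi; last by right.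
  by rewrite mulf_neq0 ?expf_neq0 //; lia.
split=> [k' e' e'_gt1|k' d' d'_ge1] i.
  have e'_ge1 := ltnW e'_gt1.
  by apply/eqP; rewrite -eqz_nat lin ?wrc_betti_linear //; right.
by apply/eqP; rewrite -eqz_nat twi ?wrc_betti_twisted //; right.
Qed.
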